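(* Let $\alpha = \frac{A}{2C}\tau + \frac{a}{4}$, such that $A,a \in \mathbb{Z}$, $C\in \mathbb{N}$, $0 \leq a \leq 3$, and $\gcd(A,C)=1$. Then the set $S_{\alpha}$ is a quantum set for $V_{\alpha}$ with respect to the group $G_{\alpha}$. In particular, for all $\tau \in S_{\alpha}$ and $M \in G_{\alpha}$, \[ V_{\alpha}(\tau) = i^{a+1}e\left(\frac{-(C-2A)^2}{8C^2}\tau\right)\mu\left(2\alpha, \frac{\tau}{2}; \tau\right) \] and \[ V_{\alpha}(M\tau) = i^{a+1}e\left(\frac{-(C-2A)^2}{8C^2}M\tau\right)\mu\left(2\alpha, \frac{M\tau}{2}; M\tau\right) \] are well-defined.
   Context: Notation: $e(x)=e^{2\pi i x}$, $q=e^{2\pi i\tau}$. $\vartheta(z;\tau) := \sum_{v \in \mathbb{Z} +\frac{1}{2}} e^{\pi i v^2 \tau+2\pi i v\left(z+\frac{1}{2}\right)}$, $\mu(u,v;\tau) := \frac{e^{\pi i u}}{\vartheta(v;\tau)}\sum_{n\in\mathbb{Z}}\frac{(-1)^n e^{2\pi i n v}q^{\frac{n(n+1)}{2}}}{1 - e^{2\pi i u}q^{n}}$, and $V_\alpha(\tau) := i^{a+1}q^{-\frac{(2A-C)^2}{8C^2}} \mu\left(2\alpha, \frac{\tau}{2}; \tau\right)$. A subset of $\mathbb{Q}$ is a quantum set for $F$ with respect to $G\subseteq\mathrm{SL}_2(\mathbb{Z})$ if $F(x)$ and $F(Mx)$ exist (are non-singular) for all $x$ in the set and $M\in G$. Let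 $S=\{\frac hk\in\mathbb{Q}: h\in\mathbb{Z},k\in\mathbb{N},\gcd(h,k)=1, h \text{ odd}\}$, $S_{C1}=\{\frac hk\in S: C\nmid h\}$, $S_{C2}=\{\frac hk\in S: C\nmid 2h\}$, $S_{ev}=\{\frac hk\in S_{C1}: k \text{ even}\}$, and $S_\alpha=S_{C1}$ if $a\in\{0,2\}$, $S_\alpha=S_{C2}\cup S_{ev}$ if $a\in\{1,3\}$. $G_\alpha$ is generated by $\begin{pmatrix}1&0\\ r&1\end{pmatrix}$ and $\begin{pmatrix}1&s\\0&1\end{pmatrix}$, where $r=1$ if $a$ is even, $r=2$ if $a$ is odd, and $s=C$ if $C$ is even, $s=2C$ if $C$ is odd.
   Formalization: Values at rationals are read as vertical limits from the upper half-plane; the claims about V_α(Mτ) are made only when Mτ is finite, since for e.g. A=3, C=2, a=0, τ=-1, M=(1 0; 1 1) one has Mτ=∞, where V_α is singular. *)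

(* Defs.v *)
From Stdlib Require Export Reals ZArith QArith Qreals Lra Lia.
From Coquelicot Require Export Coquelicot.

Open Scope R_scope.

Definition Cexp (z : C) : C :=
  (exp (Re z) * cos (Im z), exp (Re z) * sin (Im z)).

Definition e (z : C) : C := Cexp (2 * PI * Ci * z)%C.

(* q^r for real r, where q = e^{2 pi i tau}. *)
Definition qpow (tau : C) (r : R) : C := e (r * tau)%C.

(* Coquelicot's [Series] is real-valued, hence the split into real and
   imaginary parts.  [ZSeries] is only meaningful when [ex_ZSeries] holds. *)
Definition CSeries (a : nat -> C) : C :=
  (Series (fun n => Re (a n)), Series (fun n => Im (a n))).

Definition ZSeries (a : Z -> C) : C :=
  (CSeries (fun n => a (Z.of_nat n)) +
   CSeries (fun n => a (- Z.of_nat (S n))%Z))%C.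

Definition ex_ZSeries (a : Z -> C) : Prop :=
  ex_series (fun n => Cmod (a (Z.of_nat n))) /\
  ex_series (fun n => Cmod (a (- Z.of_nat (S n))%Z)).

(* The summation index v in Z + 1/2 is written v = n + 1/2. *)
Definition theta_term (z tau : C) (n : Z) : C :=
  let v := IZR n + 1 / 2 in
  Cexp (PI * Ci * v ^ 2 * tau + 2 * PI * Ci * v * (z + 1 / 2))%C.

Definition theta (z tau : C) : C := ZSeries (theta_term z tau).

Definition mu_term (u v tau : C) (n : Z) : C :=
  (powerRZ (-1) n * Cexp (2 * PI * Ci * IZR n * v)
     * qpow tau (IZR n * (IZR n + 1) / 2)
   / (1 - Cexp (2 * PI * Ci * u) * qpow tau (IZR n)))%C.

Definition mu (u v tau : C) : C :=
  (Cexp (PI * Ci * u) / theta v tau * ZSeries (mu_term u v tau))%C.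

(* Division by zero and divergent series have default values in the formula
   for [mu]; this predicate says that none of them occurs. *)
Definition mu_defined (u v tau : C) : Prop :=
  ex_ZSeries (theta_term v tau) /\
  theta v tau <> 0%C /\
  (forall n : Z, (1 - Cexp (2 * PI * Ci * u) * qpow tau (IZR n))%C <> 0%C) /\
  ex_ZSeries (mu_term u v tau).

Definition alpha (A a N : Z) (tau : C) : C :=
  (IZR A / (2 * IZR N) * tau + IZR a / 4)%C.

Definition mu_alpha (A a N : Z) (tau : C) : C :=
  mu (2 * alpha A a N tau)%C (tau / 2)%C tau.

Definition mu_alpha_defined (A a N : Z) (tau : C) : Prop :=
  mu_defined (2 * alpha A a N tau)%C (tau / 2)%C tau.

(* For 0 <= a the exponent a + 1 is faithfully converted to nat. *)
Definition V (A a N : Z) (tau : C) : C :=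
  (Ci ^ Z.to_nat (a + 1)
   * qpow tau (- ((2 * IZR A - IZR N) ^ 2 / (8 * IZR N ^ 2)))
   * mu_alpha A a N tau)%C.

(* The series above live on the upper half-plane, so the value at a real point
   x of a function F (with domain of definition D) is its radial limit: the
   limit of F (x + i y) as y -> 0+, with F defined along the approach. *)
Definition value_at (D : C -> Prop) (F : C -> C) (x : R) (l : C) : Prop :=
  at_right 0 (fun y : R => D (x, y)) /\
  filterlim (fun y : R => F (x, y)) (at_right 0) (locally l).

Definition exists_at (D : C -> Prop) (F : C -> C) (x : R) : Prop :=
  exists l : C, value_at D F x l.

Record SL2Z : Type := mkSL2Z {
  m11 : Z; m12 : Z;
  m21 : Z; m22 : Z;
  SL2Z_det : (m11 * m22 - m12 * m21 = 1)%Z }.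

Lemma SL2Z_one_det : (1 * 1 - 0 * 0 = 1)%Z.
Proof. reflexivity. Qed.

Lemma SL2Z_mul_det (M N : SL2Z) :
  ((m11 M * m11 N + m12 M * m21 N) * (m21 M * m12 N + m22 M * m22 N)
   - (m11 M * m12 N + m12 M * m22 N) * (m21 M * m11 N + m22 M * m21 N) = 1)%Z.
Proof.
  transitivity ((m11 M * m22 M - m12 M * m21 M)
                * (m11 N * m22 N - m12 N * m21 N))%Z; [ring|].
  now rewrite !SL2Z_det.
Qed.

Lemma SL2Z_inv_det (M : SL2Z) :
  (m22 M * m11 M - (- m12 M) * (- m21 M) = 1)%Z.
Proof. rewrite <- (SL2Z_det M); ring. Qed.

Lemma SL2Z_lower_det (r : Z) : (1 * 1 - 0 * r = 1)%Z.
Proof. ring. Qed.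

Lemma SL2Z_upper_det (s : Z) : (1 * 1 - s * 0 = 1)%Z.
Proof. ring. Qed.

Definition SL2Z_one : SL2Z := mkSL2Z 1 0 0 1 SL2Z_one_det.
Definition SL2Z_mul (M N : SL2Z) : SL2Z := mkSL2Z _ _ _ _ (SL2Z_mul_det M N).
Definition SL2Z_inv (M : SL2Z) : SL2Z := mkSL2Z _ _ _ _ (SL2Z_inv_det M).
Definition SL2Z_lower (r : Z) : SL2Z := mkSL2Z 1 0 r 1 (SL2Z_lower_det r).
Definition SL2Z_upper (s : Z) : SL2Z := mkSL2Z 1 s 0 1 (SL2Z_upper_det s).

Inductive generated (X : SL2Z -> Prop) : SL2Z -> Prop :=
| generated_gen : forall M, X M -> generated X M
| generated_one : generated X SL2Z_one
| generated_mul : forall M N,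
    generated X M -> generated X N -> generated X (SL2Z_mul M N)
| generated_inv : forall M, generated X M -> generated X (SL2Z_inv M).

(* M x = (m11 x + m12) / (m21 x + m22); it is a rational number precisely when
   [finite_image M x], and the cusp at infinity otherwise. *)
Definition finite_image (M : SL2Z) (x : Q) : Prop :=
  ~ (inject_Z (m21 M) * x + inject_Z (m22 M) == 0)%Q.

Definition moebius (M : SL2Z) (x : Q) : Q :=
  ((inject_Z (m11 M) * x + inject_Z (m12 M))
   / (inject_Z (m21 M) * x + inject_Z (m22 M)))%Q.

(* As usual for quantum modular forms, M x is only considered for x different
   from M^{-1}(infinity). *)
Definition quantum_set (D : C -> Prop) (F : C -> C)
    (S : Q -> Prop) (G : SL2Z -> Prop) : Prop :=
  forall (x : Q) (M : SL2Z), S x -> G M ->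
    exists_at D F (Q2R x) /\
    (finite_image M x -> exists_at D F (Q2R (moebius M x))).

Definition reduced (x : Q) (h : Z) (k : positive) : Prop :=
  Z.gcd h (Zpos k) = 1%Z /\ (x == h # k)%Q.

Definition S_C1 (N : Z) (x : Q) : Prop :=
  exists h k, reduced x h k /\ Z.Odd h /\ ~ (N | h)%Z.

Definition S_C2 (N : Z) (x : Q) : Prop :=
  exists h k, reduced x h k /\ Z.Odd h /\ ~ (N | 2 * h)%Z.

Definition S_ev (N : Z) (x : Q) : Prop :=
  exists h k, reduced x h k /\ Z.Odd h /\ ~ (N | h)%Z /\ Z.Even (Zpos k).

Definition S_alpha (a N : Z) (x : Q) : Prop :=
  ((a = 0%Z \/ a = 2%Z) /\ S_C1 N x) \/
  ((a = 1%Z \/ a = 3%Z) /\ (S_C2 N x \/ S_ev N x)).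

Definition G_alpha (a N : Z) : SL2Z -> Prop :=
  let r := if Z.even a then 1%Z else 2%Z in
  let s := if Z.even N then N else (2 * N)%Z in
  generated (fun M => M = SL2Z_lower r \/ M = SL2Z_upper s).

(* At a real point x, the formula
     V_alpha(x) = i^{a+1} e(-(N-2A)^2/(8 N^2) x) mu(2 alpha, x/2; x)
   holds with both V_alpha(x) and mu(2 alpha, x/2; x) well-defined. *)
Definition V_formula_at (A a N : Z) (x : R) : Prop :=
  exists m : C,
    value_at (mu_alpha_defined A a N) (mu_alpha A a N) x m /\
    value_at (mu_alpha_defined A a N) (V A a N) x
      (Ci ^ Z.to_nat (a + 1)
       * e (RtoC (- (IZR N - 2 * IZR A) ^ 2 / (8 * IZR N ^ 2)) * RtoC x)
       * m)%C.

(* Main.v *)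
Require Import Defs.

(** At [tau = h/k + i y] the summands of [theta(tau/2; tau)] and of the series in
    [mu(2 alpha, tau/2; tau)] are, up to relative errors [O(y (|n| + 1))], of
    the form [c(n) exp(-pi y (n+1)^2)] with [c] of period [k]: for [mu] because
    [q^n] tends to the root of unity [e(n h / k)], the condition defining
    [S_alpha] saying exactly that no limiting denominator
    [1 - e(2 alpha) q^n] vanishes.  Abel summation gives
    [sum_n c(n) exp(-pi y (n+1)^2) = mean(c) T(y) + O(1)] with
    [T(y) = sum_m exp(-pi y m^2)], which tends to infinity as [y -> 0+].  For
    [theta] the mean of [c] is a unit multiple of
    [1/k sum_(m mod k) (-1)^m e(h m^2 / (2 k))], a Gauss sum that is nonzero
    since [h] is odd.  Hence the quotient of the two series converges.  Finally
    the condition on [h/k], read on coprime pairs [(h, k)], is preserved by the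
    generators of [G_alpha]. *)

(** * Exponentials *)

Lemma Cexp_plus (z w : C) : Cexp (z + w) = (Cexp z * Cexp w)%C.
Proof.
  unfold Cexp; destruct z as [a b], w as [c d]; cbn.
  rewrite exp_plus, cos_plus, sin_plus.
  unfold Cmult; cbn; f_equal; ring.
Qed.

Lemma e_plus (z w : C) : e (z + w) = (e z * e w)%C.
Proof. unfold e; rewrite <- Cexp_plus; f_equal; ring. Qed.

Lemma e_real (t : R) : e t = (cos (2 * PI * t), sin (2 * PI * t)).
Proof.
  unfold e, Cexp; cbn.
  match goal with |- (exp ?u * cos ?v, _) = _ =>
    replace u with 0 by ring; replace v with (2 * PI * t) by ring end.
  rewrite exp_0; f_equal; ring.
Qed.

Lemma e_real_plus (s t : R) : e (s + t)%R = (e s * e t)%C.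
Proof. rewrite RtoC_plus; apply e_plus. Qed.

Lemma Cexp_polar (z : C) (r t : R) :
  Re z = r -> Im z = 2 * PI * t -> Cexp z = (exp r * e t)%C.
Proof.
  intros Hr Ht; rewrite e_real; unfold Cexp; rewrite Hr, Ht.
  unfold Cmult; cbn; f_equal; ring.
Qed.

Lemma e_IZR (n : Z) : e (IZR n) = 1%C.
Proof.
  assert (Hs : sin (PI * IZR n) = 0)
    by (apply sin_eq_0_1; exists n; ring).
  rewrite e_real.
  replace (2 * PI * IZR n) with (2 * (PI * IZR n)) by ring.
  rewrite cos_2a_sin, sin_2a, Hs.
  unfold RtoC; f_equal; ring.
Qed.

Lemma e_real_periodic (t : R) (n : Z) : e (t + IZR n)%R = e t.
Proof. rewrite e_real_plus, e_IZR; ring. Qed.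

(** From [cos (2 pi t) = 1 - 2 sin^2 (pi t)], the value 1 of the cosine forces [sin (pi t) = 0]. *)
Lemma e_real_eq_1 (t : R) : e t = 1%C -> exists n : Z, t = IZR n.
Proof.
  rewrite e_real; intros H; injection H as Hc _.
  replace (2 * PI * t) with (2 * (PI * t)) in Hc by ring.
  rewrite cos_2a_sin in Hc.
  assert (Hs : sin (PI * t) = 0) by nra.
  destruct (sin_eq_0_0 _ Hs) as [n Hn]; exists n.
  apply (Rmult_eq_reg_l PI); [lra | apply PI_neq0].
Qed.

Lemma Cmod_e_real (t : R) : Cmod (e t) = 1.
Proof.
  rewrite e_real; unfold Cmod; cbn [fst snd].
  rewrite <- sqrt_1; f_equal.
  pose proof (sin2_cos2 (2 * PI * t)) as H; unfold Rsqr in H; nra.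
Qed.

Lemma e_real_neq_0 (t : R) : e t <> 0%C.
Proof. apply Cmod_gt_0; rewrite Cmod_e_real; lra. Qed.

(** * Periodic coefficients and Abel summation *)

(** The index [n] itself is excluded, whereas [sum_n] includes it; hence the shift [S n] wherever
    the two are compared. *)
Fixpoint Csum (f : nat -> C) (n : nat) : C :=
  match n with
  | O => 0%C
  | S m => (Csum f m + f m)%C
  end.

Lemma Csum_ext (f g : nat -> C) (n : nat) :
  (forall i, (i < n)%nat -> f i = g i) -> Csum f n = Csum g n.
Proof.
  induction n as [|n IH]; cbn; intros H; [reflexivity|].
  rewrite IH, H; auto with arith.
Qed.

Lemma Csum_plus (f g : nat -> C) (n : nat) :
  Csum (fun i => f i + g i)%C n = (Csum f n + Csum g n)%C.
Proof. induction n as [|n IH]; cbn; [|rewrite IH]; ring. Qed.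

Lemma Csum_scal (a : C) (f : nat -> C) (n : nat) :
  Csum (fun i => a * f i)%C n = (a * Csum f n)%C.
Proof. induction n as [|n IH]; cbn; [|rewrite IH]; ring. Qed.

Lemma Csum_const (a : C) (n : nat) : Csum (fun _ => a) n = (INR n * a)%C.
Proof.
  induction n as [|n IH]; [cbn; ring|].
  cbn [Csum]; rewrite IH, S_INR, RtoC_plus; ring.
Qed.

Lemma Csum_head (f : nat -> C) (n : nat) :
  Csum f (S n) = (f O + Csum (fun i => f (S i)) n)%C.
Proof.
  induction n as [|n IH]; [cbn; ring|].
  cbn [Csum] in *; rewrite IH; ring.
Qed.

Lemma Csum_add (f : nat -> C) (m n : nat) :
  Csum f (m + n) = (Csum f m + Csum (fun i => f (m + i)%nat) n)%C.
Proof.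
  induction n as [|n IH]; [rewrite Nat.add_0_r; cbn; ring|].
  rewrite Nat.add_succ_r; cbn; rewrite IH; ring.
Qed.

Lemma Csum_rev (f : nat -> C) (n : nat) :
  Csum (fun i => f (n - S i)%nat) n = Csum f n.
Proof.
  revert f; induction n as [|n IH]; intros f; [reflexivity|].
  rewrite Csum_head; cbn [Csum].
  rewrite Nat.sub_succ, Nat.sub_0_r, <- (IH f).
  rewrite Cplus_comm; f_equal.
Qed.

Lemma Csum_switch (f : nat -> nat -> C) (m n : nat) :
  Csum (fun i => Csum (f i) n) m = Csum (fun j => Csum (fun i => f i j) m) n.
Proof.
  induction m as [|m IH]; cbn.
  - induction n as [|n IHn]; cbn; [|rewrite <- IHn]; ring.
  - now rewrite IH, Csum_plus.
Qed.

Lemma Cmod_Csum_le (f : nat -> C) (u : nat -> R) (n : nat) :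
  (forall i, Cmod (f i) <= u i) -> Cmod (Csum f (S n)) <= sum_n u n.
Proof.
  intros H; induction n as [|n IH].
  - rewrite sum_O; cbn; rewrite Cplus_0_l; apply H.
  - rewrite sum_Sn; cbn [Csum] in *.
    eapply Rle_trans; [apply Cmod_triangle|].
    now apply Rplus_le_compat.
Qed.

Lemma Re_Csum (a : nat -> C) (n : nat) :
  sum_n (fun i => Re (a i)) n = Re (Csum a (S n)).
Proof.
  induction n as [|n IH]; [rewrite sum_O; cbn [Csum]; now rewrite Cplus_0_l|].
  rewrite sum_Sn, IH; reflexivity.
Qed.

Lemma Im_Csum (a : nat -> C) (n : nat) :
  sum_n (fun i => Im (a i)) n = Im (Csum a (S n)).
Proof.
  induction n as [|n IH]; [rewrite sum_O; cbn [Csum]; now rewrite Cplus_0_l|].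
  rewrite sum_Sn, IH; reflexivity.
Qed.

(** * Absolutely convergent complex series *)

Lemma Rabs_Im_le (z : C) : Rabs (Im z) <= Cmod z.
Proof.
  eapply Rle_trans; [|apply Rmax_Cmod]; apply Rmax_r.
Qed.

Lemma ex_series_Re_Im (a : nat -> C) :
  ex_series (fun n => Cmod (a n)) ->
  ex_series (fun n => Re (a n)) /\ ex_series (fun n => Im (a n)).
Proof.
  intros H; split; eapply (@ex_series_le R_AbsRing R_CompleteNormedModule);
    try exact H; intros n; [apply re_le_Cmod | apply Rabs_Im_le].
Qed.

(** [CSeries] is defined by components, so the passage to the limit is made on squared moduli, which
    are polynomials in the real and imaginary parts. *)
Lemma Cmod_CSeries_le_sup (a : nat -> C) (B : R) :
  ex_series (fun n => Cmod (a n)) ->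
  (forall n, Cmod (Csum a n) <= B) -> Cmod (CSeries a) <= B.
Proof.
  intros Ha HB.
  destruct (ex_series_Re_Im a Ha) as [HR HI].
  apply Series_correct in HR; apply Series_correct in HI.
  assert (HB0 : 0 <= B) by (eapply Rle_trans; [apply Cmod_ge_0 | apply (HB O)]).
  rewrite <- (Rabs_pos_eq (Cmod _)) by apply Cmod_ge_0.
  rewrite <- (Rabs_pos_eq B) by exact HB0.
  apply Rsqr_le_abs_0; rewrite !Rsqr_pow2, Cmod2_alt.
  assert (HL : is_lim_seq (fun n => sum_n (fun i => Re (a i)) n ^ 2
                                  + sum_n (fun i => Im (a i)) n ^ 2)
                 (Re (CSeries a) ^ 2 + Im (CSeries a) ^ 2)).
  { cbn [CSeries Re Im fst snd pow].
    apply is_lim_seq_plus'; apply is_lim_seq_mult'; try apply HR; try apply HI;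
      apply is_lim_seq_mult'; try apply HR; try apply HI;
      apply is_lim_seq_const. }
  refine (is_lim_seq_le _ _ (Finite _) (Finite _) _ HL (is_lim_seq_const _)).
  intros n; rewrite Re_Csum, Im_Csum, <- Cmod2_alt.
  apply pow_incr; split; [apply Cmod_ge_0 | apply HB].
Qed.

Lemma sum_n_le_Series (u : nat -> R) (n : nat) :
  (forall i, 0 <= u i) -> ex_series u -> sum_n u n <= Series u.
Proof.
  intros Hu Hex.
  refine (is_lim_seq_incr_compare (sum_n u) (Series u) _ _ n).
  - exact (Series_correct u Hex).
  - intros m; rewrite sum_Sn; pose proof (Hu (S m)); cbv [plus]; cbn; lra.
Qed.

Lemma Cmod_CSeries_le (a : nat -> C) (u : nat -> R) :
  (forall i, Cmod (a i) <= u i) -> ex_series u ->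
  Cmod (CSeries a) <= Series u.
Proof.
  intros H Hu.
  assert (Hu0 : forall i, 0 <= u i)
    by (intros i; eapply Rle_trans; [apply Cmod_ge_0 | apply H]).
  apply Cmod_CSeries_le_sup.
  - refine (@ex_series_le R_AbsRing R_CompleteNormedModule _ u _ Hu).
    intros n; cbv [norm]; cbn; unfold abs; cbn.
    rewrite Rabs_pos_eq; [apply H | apply Cmod_ge_0].
  - intros [|n].
    + cbn [Csum]; rewrite Cmod_0.
      apply (Rle_trans _ (sum_n u 0)); [rewrite sum_O; apply Hu0|].
      now apply sum_n_le_Series.
    + eapply Rle_trans; [now apply Cmod_Csum_le | now apply sum_n_le_Series].
Qed.

Lemma ex_series_Cmod_le (a : nat -> C) (u : nat -> R) :
  (forall i, Cmod (a i) <= u i) -> ex_series u ->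
  ex_series (fun i => Cmod (a i)).
Proof.
  intros H; apply (@ex_series_le R_AbsRing R_CompleteNormedModule).
  intros n; cbv [norm]; cbn; unfold abs; cbn.
  rewrite Rabs_pos_eq; [apply H | apply Cmod_ge_0].
Qed.

Lemma CSeries_minus (a b : nat -> C) :
  ex_series (fun n => Cmod (a n)) -> ex_series (fun n => Cmod (b n)) ->
  CSeries (fun n => a n - b n)%C = (CSeries a - CSeries b)%C.
Proof.
  intros Ha Hb.
  destruct (ex_series_Re_Im a Ha), (ex_series_Re_Im b Hb).
  unfold CSeries, Cminus, Cplus, Copp; cbn.
  now f_equal; apply Series_minus.
Qed.

Lemma CSeries_scal_real (c : C) (v : nat -> R) :
  CSeries (fun n => c * v n)%C = (c * Series v)%C.
Proof.
  unfold CSeries, Cmult; cbn; f_equal.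
  - rewrite Rmult_0_r, Rminus_0_r, <- Series_scal_l.
    apply Series_ext; intros n; ring.
  - rewrite Rmult_0_r, Rplus_0_l, <- Series_scal_l.
    apply Series_ext; intros n; ring.
Qed.

(** Summation by parts: with [D_n] the partial sums of [d], the difference [sum d_i v_i - D_n v_n]
    equals [sum D_(i+1) (v_i - v_(i+1))]. Since [v] decreases, this telescopes to at most
    [K (v_0 - v_n)], and the boundary term adds at most [K v_n]. *)
Lemma Cmod_Csum_Abel (d : nat -> C) (v : nat -> R) (K : R) (n : nat) :
  (forall i, Cmod (Csum d i) <= K) ->
  (forall i, 0 <= v i) -> (forall i, v (S i) <= v i) ->
  Cmod (Csum (fun i => d i * v i)%C n) <= K * v O.
Proof.
  intros HK Hv Hdec.
  assert (H : Cmod (Csum (fun i => d i * v i)%C n - Csum d n * v n)%C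
              <= K * (v O - v n)).
  { induction n as [|n IH].
    - cbn; replace (0 - 0 * v O)%C with (RtoC 0) by ring.
      rewrite Cmod_0; lra.
    - cbn [Csum].
      replace (Csum (fun i => d i * v i) n + d n * v n
               - (Csum d n + d n) * v (S n))%C
        with ((Csum (fun i => d i * v i) n - Csum d n * v n)
              + Csum d (S n) * (v n - v (S n))%R)%C
        by (cbn [Csum]; rewrite RtoC_minus; ring).
      eapply Rle_trans; [apply Cmod_triangle|].
      rewrite Cmod_mult, Cmod_R, Rabs_pos_eq by (pose proof (Hdec n); lra).
      pose proof (HK (S n)); pose proof (Hdec n); nra. }
  replace (Csum (fun i => d i * v i)%C n)
    with ((Csum (fun i => d i * v i) n - Csum d n * v n)
          + Csum d n * v n)%C by ring.
  eapply Rle_trans; [apply Cmod_triangle|].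
  rewrite Cmod_mult, Cmod_R, (Rabs_pos_eq (v n)) by apply Hv.
  pose proof (HK n); pose proof (Hv n); nra.
Qed.

Lemma periodic_bounded (f : nat -> R) (M : nat) :
  (0 < M)%nat -> (forall n, f (n + M)%nat = f n) ->
  exists K, forall n, f n <= K.
Proof.
  intros HM Hper.
  assert (Hfin : forall m, exists K, forall n, (n < m)%nat -> f n <= K).
  { induction m as [|m [K HK]].
    - exists 0; intros n Hn; lia.
    - exists (Rmax K (f m)); intros n Hn.
      destruct (Nat.eq_dec n m) as [->|Hne]; [apply Rmax_r|].
      eapply Rle_trans; [apply HK; lia | apply Rmax_l]. }
  destruct (Hfin M) as [K HK]; exists K.
  intros n; induction n as [n IH] using (well_founded_induction lt_wf).
  destruct (Nat.lt_ge_cases n M) as [Hlt|Hge]; [now apply HK|].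
  replace n with (n - M + M)%nat by lia; rewrite Hper; apply IH; lia.
Qed.

(* Abel summation against the mean-zero sequence [c - mean], whose partial
   sums are periodic. *)
Lemma periodic_series_bound (c : nat -> C) (M : nat) :
  (0 < M)%nat -> (forall n, c (n + M)%nat = c n) ->
  exists K, 0 <= K /\ forall v : nat -> R,
    (forall i, 0 <= v i) -> (forall i, v (S i) <= v i) -> ex_series v ->
    ex_series (fun n => Cmod (c n * v n)) /\
    Cmod (CSeries (fun n => c n * v n) - Csum c M / INR M * Series v)%C
      <= K * v O.
Proof.
  intros HM Hper.
  set (L := (Csum c M / INR M)%C).
  set (d := fun n => (c n - L)%C).
  assert (HM0 : INR M <> 0) by (apply not_0_INR; lia).
  assert (HdM : Csum d M = 0%C).
  { transitivity (Csum (fun i => c i + (-1) * L)%C M).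
    - apply Csum_ext; intros; unfold d; ring.
    - rewrite Csum_plus, Csum_const; unfold L; field.
      intros H; apply HM0; now apply RtoC_inj. }
  assert (HdP : forall n, Csum d (n + M) = Csum d n).
  { intros n; rewrite Nat.add_comm, Csum_add, HdM, Cplus_0_l.
    apply Csum_ext; intros i _; unfold d.
    now rewrite Nat.add_comm, Hper. }
  destruct (periodic_bounded (fun n => Cmod (Csum d n)) M HM) as [K HK];
    [intros n; now rewrite HdP|].
  destruct (periodic_bounded (fun n => Cmod (c n)) M HM) as [Kc HKc];
    [intros n; now rewrite Hper|].
  exists K; split.
  { eapply Rle_trans; [apply Cmod_ge_0 | apply (HK O)]. }
  intros v Hv Hdec Hex.
  assert (Hexc : ex_series (fun n => Cmod (c n * v n))).
  { apply (ex_series_Cmod_le _ (fun n => Kc * v n)).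
    - intros i; rewrite Cmod_mult, Cmod_R, Rabs_pos_eq by apply Hv.
      apply Rmult_le_compat_r; auto.
    - now apply (@ex_series_scal_l R_AbsRing R_NormedModule). }
  assert (HexL : ex_series (fun n => Cmod (L * v n))).
  { apply (ex_series_Cmod_le _ (fun n => Cmod L * v n)).
    - intros i; rewrite Cmod_mult, Cmod_R, Rabs_pos_eq by apply Hv; lra.
    - now apply (@ex_series_scal_l R_AbsRing R_NormedModule). }
  split; [exact Hexc|].
  rewrite <- CSeries_scal_real, <- CSeries_minus by assumption.
  apply Cmod_CSeries_le_sup.
  - apply (ex_series_Cmod_le _ (fun n => Cmod (c n * v n) + Cmod (L * v n))).
    + intros i; unfold Cminus.
      eapply Rle_trans; [apply Cmod_triangle|]; rewrite Cmod_opp; lra.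
    + now apply (@ex_series_plus R_AbsRing R_NormedModule).
  - intros n.
    replace (Csum (fun n => c n * v n - L * v n)%C n)
      with (Csum (fun i => d i * v i)%C n)
      by (apply Csum_ext; intros; unfold d; ring).
    now apply Cmod_Csum_Abel.
Qed.

(** The bound [B] is fixed before [y], the weights and the summands, so it is uniform as [y] tends
    to 0. The factor [y] in the pointwise error offsets the growth of [Series u], whose product with
    [y] is at most [U]. *)
Lemma perturbed_periodic_series_bound (c : nat -> C) (M : nat) (K0 U : R) :
  (0 < M)%nat -> (forall n, c (n + M)%nat = c n) -> 0 <= K0 ->
  exists B, forall (y : R) (v u : nat -> R) (f : nat -> C),
    (forall i, 0 <= v i) -> (forall i, v (S i) <= v i) -> v O <= 1 ->
    (forall i, v i <= u i) -> ex_series u -> y * Series u <= U ->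
    (forall i, Cmod (f i - c i * v i) <= K0 * y * u i) ->
    ex_series (fun n => Cmod (f n)) /\
    Cmod (CSeries f - Csum c M / INR M * Series v)%C <= B.
Proof.
  intros HM Hper HK0.
  destruct (periodic_series_bound c M HM Hper) as (K & HK & Hc).
  (* [K] comes from Abel summation with [v O <= 1], and [K0 * U] from the total error. *)
  exists (K + K0 * U).
  intros y v u f Hv Hdec Hv0 Hvu Hu HU Hf.
  assert (Hexv : ex_series v).
  { refine (@ex_series_le R_AbsRing R_CompleteNormedModule _ u _ Hu).
    intros n; cbv [norm]; cbn; unfold abs; cbn.
    rewrite Rabs_pos_eq; auto. }
  destruct (Hc v Hv Hdec Hexv) as [Hexc HL].
  assert (Hu' : ex_series (fun n => K0 * y * u n))
    by now apply (@ex_series_scal_l R_AbsRing R_NormedModule).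
  assert (Hexf : ex_series (fun n => Cmod (f n))).
  { apply (ex_series_Cmod_le _ (fun n => Cmod (c n * v n) + K0 * y * u n)).
    - intros i.
      replace (f i) with (c i * v i + (f i - c i * v i))%C by ring.
      eapply Rle_trans; [apply Cmod_triangle|].
      apply Rplus_le_compat_l.
      now replace (c i * v i + (f i - c i * v i) - c i * v i)%C
        with (f i - c i * v i)%C by ring.
    - now apply (@ex_series_plus R_AbsRing R_NormedModule). }
  split; [exact Hexf|].
  replace (CSeries f - Csum c M / INR M * Series v)%C
    with (CSeries (fun n => f n - c n * v n)
          + (CSeries (fun n => c n * v n) - Csum c M / INR M * Series v))%C
    by (rewrite CSeries_minus by assumption; ring).
  eapply Rle_trans; [apply Cmod_triangle|].
  assert (H : Cmod (CSeries (fun n => f n - c n * v n)%C) <= K0 * (y * Series u)).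
  { rewrite <- Rmult_assoc, <- Series_scal_l; now apply Cmod_CSeries_le. }
  nra.
Qed.

(** * Gaussian weights *)

Definition gaussian (y : R) (m : Z) : R := exp (- (PI * y * IZR m ^ 2)).

Lemma PI_ge_1 : 1 <= PI.
Proof. pose proof PI2_1; lra. Qed.

Lemma gaussian_pos (y : R) (m : Z) : 0 < gaussian y m.
Proof. apply exp_pos. Qed.

Lemma gaussian_opp (y : R) (m : Z) : gaussian y (- m) = gaussian y m.
Proof. unfold gaussian; rewrite opp_IZR; do 2 f_equal; ring. Qed.

(** The ratio of consecutive weights is [exp (pi y (2 j + 1))], which is at least [1 + y (j + 1)].
    This turns the first moment of the weights into a telescoping sum. *)
Lemma gaussian_telescope (y : R) (j : nat) : 0 < y ->
  y * (INR j + 1) * gaussian y (Z.of_nat (S j))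
    <= gaussian y (Z.of_nat j) - gaussian y (Z.of_nat (S j)).
Proof.
  intros Hy; pose proof PI_ge_1; pose proof (pos_INR j).
  assert (E : gaussian y (Z.of_nat j)
              = gaussian y (Z.of_nat (S j)) * exp (PI * y * (2 * INR j + 1))).
  { unfold gaussian; rewrite <- exp_plus, <- !INR_IZR_INZ, S_INR; f_equal; ring. }
  pose proof (exp_ineq1_le (PI * y * (2 * INR j + 1))).
  pose proof (gaussian_pos y (Z.of_nat (S j))).
  assert (y * (INR j + 1) <= PI * y * (2 * INR j + 1)).
  { assert (1 * (y * (INR j + 1)) <= PI * (y * (2 * INR j + 1)))
      by (apply Rmult_le_compat; nra).
    nra. }
  rewrite E; nra.
Qed.

Lemma gaussian_le_1 (y : R) (m : Z) : 0 < y -> gaussian y m <= 1.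
Proof.
  intros Hy; unfold gaussian; set (s := PI * y * IZR m ^ 2).
  assert (Hs : 0 <= s).
  { pose proof PI_ge_1; pose proof (pow2_ge_0 (IZR m)).
    assert (0 <= PI * y) by nra; unfold s; nra. }
  rewrite exp_Ropp; pose proof (exp_ineq1_le s).
  rewrite <- Rinv_1; apply Rinv_le_contravar; lra.
Qed.

Lemma gaussian_decr (y : R) (j : nat) : 0 < y ->
  gaussian y (Z.of_nat (S j)) <= gaussian y (Z.of_nat j).
Proof.
  intros Hy; pose proof (gaussian_telescope y j Hy); pose proof (pos_INR j).
  pose proof (gaussian_pos y (Z.of_nat (S j))).
  assert (0 <= y * (INR j + 1)) by nra; nra.
Qed.

(** The weights [u] carry the factor [|n| + 1] of the error terms at [n = j >= 0]. Summing the
    telescoping inequality bounds [y] times each partial sum by 1. *)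
Lemma gaussian_moment (y : R) : 0 < y ->
  let u := fun j => (INR j + 1) * gaussian y (Z.of_nat (S j)) in
  ex_series u /\ y * Series u <= 1.
Proof.
  intros Hy u.
  assert (Hu : forall j, 0 <= u j).
  { intros j; unfold u; pose proof (pos_INR j).
    pose proof (gaussian_pos y (Z.of_nat (S j))); nra. }
  assert (Hsum : forall n, y * sum_n u n <= 1 - gaussian y (Z.of_nat (S n))).
  { assert (H0 : gaussian y (Z.of_nat 0) = 1)
      by (unfold gaussian; rewrite <- exp_0; f_equal; cbn; ring).
    induction n as [|n IH].
    - rewrite sum_O; pose proof (gaussian_telescope y 0 Hy) as H; unfold u; lra.
    - rewrite sum_Sn; cbv [plus]; cbn -[gaussian INR Z.of_nat sum_n].
      pose proof (gaussian_telescope y (S n) Hy) as H.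
      unfold u at 2; lra. }
  assert (Hsum' : forall n, sum_n u n <= / y).
  { intros n; apply (Rmult_le_reg_l y); [exact Hy|].
    rewrite Rinv_r by lra.
    pose proof (Hsum n); pose proof (gaussian_pos y (Z.of_nat (S n))); lra. }
  assert (Hex : ex_series u).
  { destruct (ex_finite_lim_seq_incr (sum_n u) (/ y)) as [l Hl]; auto.
    - intros n; rewrite sum_Sn; pose proof (Hu (S n)).
      cbv [plus]; cbn -[u]; lra.
    - now exists l. }
  split; [exact Hex|].
  apply (Rmult_le_reg_l (/ y)); [now apply Rinv_0_lt_compat|].
  rewrite <- Rmult_assoc, Rinv_l, Rmult_1_l, Rmult_1_r by lra.
  refine (is_lim_seq_le _ _ (Finite _) (Finite _) Hsum' _ (is_lim_seq_const _)).
  exact (Series_correct u Hex).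
Qed.

(* The theta series [sum_m exp(-pi y m^2)] with [m = n + 1], split as in
   [ZSeries]. *)
Definition gaussian_series (y : R) : R :=
  Series (fun n => gaussian y (Z.of_nat n + 1))
  + Series (fun n => gaussian y (- Z.of_nat (S n) + 1)).

Lemma gaussian_pos_index (y : R) (n : nat) :
  gaussian y (Z.of_nat n + 1) = gaussian y (Z.of_nat (S n)).
Proof. f_equal; lia. Qed.

Lemma gaussian_neg_index (y : R) (n : nat) :
  gaussian y (- Z.of_nat (S n) + 1) = gaussian y (Z.of_nat n).
Proof. rewrite <- (gaussian_opp y (Z.of_nat n)); f_equal; lia. Qed.

(** The companion bound at [n = - (j + 1)], where [|n| + 1 = j + 2] and [|n + 1| = j]. The term
    [j = 0] contributes at most 2; the others are at most three times those of the previous moment,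
    since [j + 3 <= 3 (j + 1)]. Hence 5 = 2 + 3. *)
Lemma gaussian_moment_neg (y : R) : 0 < y < 1 ->
  let u := fun j => (INR j + 2) * gaussian y (Z.of_nat j) in
  ex_series u /\ y * Series u <= 5.
Proof.
  intros [Hy Hy1] u.
  destruct (gaussian_moment y Hy) as [Hex HS].
  set (v := fun j => (INR j + 1) * gaussian y (Z.of_nat (S j))) in *.
  assert (Hv3 : ex_series (fun j => 3 * v j))
    by now apply (@ex_series_scal_l R_AbsRing R_NormedModule).
  assert (Hle : forall j, 0 <= u (S j) <= 3 * v j).
  { intros j; unfold u, v; rewrite S_INR; pose proof (pos_INR j).
    pose proof (gaussian_pos y (Z.of_nat (S j))); nra. }
  assert (Hex' : ex_series u).
  { apply ex_series_incr_1.
    refine (@ex_series_le R_AbsRing R_CompleteNormedModule _ _ _ Hv3).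
    intros n; cbv [norm]; cbn -[u v]; unfold abs; cbn -[u v].
    rewrite Rabs_pos_eq; apply Hle. }
  split; [exact Hex'|].
  rewrite Series_incr_1 by exact Hex'.
  assert (H : Series (fun k => u (S k)) <= 3 * Series v).
  { rewrite <- Series_scal_l; now apply Series_le. }
  assert (H0 : u O <= 2).
  { unfold u; pose proof (gaussian_le_1 y (Z.of_nat 0) Hy); cbn [INR]; lra. }
  nra.
Qed.

(** * Two-sided series with periodic coefficients and Gaussian weights *)

Lemma periodic_Z_nat (T : Type) (c : Z -> T) (M : nat) :
  (forall n, c (n + Z.of_nat M)%Z = c n) ->
  (forall j, c (Z.of_nat (j + M)) = c (Z.of_nat j)) /\
  (forall j, c (- Z.of_nat (S (j + M)))%Z = c (- Z.of_nat (S j))%Z).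
Proof.
  intros Hper; split; intros j.
  - rewrite Nat2Z.inj_add; apply Hper.
  - rewrite <- (Hper (- Z.of_nat (S (j + M)))%Z); f_equal; lia.
Qed.

(** The weight is centred at [n = -1], so it decreases along each of the two halves [n >= 0] and
    [n < 0], and the one-sided estimate applies to both. The two main terms combine because [c] has
    the same mean along either half. *)
Lemma ZSeries_periodic_gauss (c : Z -> C) (M : nat) (K0 : R) :
  (0 < M)%nat -> (forall n, c (n + Z.of_nat M)%Z = c n) -> 0 <= K0 ->
  exists B, forall (y : R) (f : Z -> C), 0 < y < 1 ->
    (forall n, Cmod (f n - c n * gaussian y (n + 1))
               <= K0 * y * ((Rabs (IZR n) + 1) * gaussian y (n + 1))) ->
    ex_ZSeries f /\
    Cmod (ZSeries f
          - Csum (fun j => c (Z.of_nat j)) M / INR M * gaussian_series y)%C <= B.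
Proof.
  intros HM Hper HK0.
  destruct (periodic_Z_nat _ c M Hper) as [Hp Hn].
  destruct (perturbed_periodic_series_bound (fun j => c (Z.of_nat j))
              M K0 1 HM Hp HK0) as [B1 HB1].
  destruct (perturbed_periodic_series_bound (fun j => c (- Z.of_nat (S j))%Z)
              M K0 5 HM Hn HK0) as [B2 HB2].
  (* The indices -1, ..., -M are, up to the period, M - 1, ..., 0. *)
  assert (Hmean : Csum (fun j => c (- Z.of_nat (S j))%Z) M
                  = Csum (fun j => c (Z.of_nat j)) M).
  { rewrite <- (Csum_rev (fun j => c (Z.of_nat j))).
    apply Csum_ext; intros i Hi.
    rewrite <- (Hper (- Z.of_nat (S i))%Z); f_equal; lia. }
  exists (B1 + B2); intros y f [Hy Hy1] Hf.
  destruct (gaussian_moment y Hy) as [HexP HSP].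
  destruct (gaussian_moment_neg y (conj Hy Hy1)) as [HexN HSN].
  destruct (HB1 y (fun n => gaussian y (Z.of_nat n + 1))
              (fun j => (INR j + 1) * gaussian y (Z.of_nat (S j)))
              (fun n => f (Z.of_nat n))) as [Hex1 H1]; auto.
  { intros i; apply Rlt_le, gaussian_pos. }
  { intros i; rewrite !gaussian_pos_index; now apply gaussian_decr. }
  { now apply gaussian_le_1. }
  { intros i; rewrite gaussian_pos_index; pose proof (pos_INR i).
    pose proof (gaussian_pos y (Z.of_nat (S i))); nra. }
  { intros i; eapply Rle_trans; [apply Hf|].
    rewrite gaussian_pos_index, INR_IZR_INZ, Rabs_pos_eq; [lra|].
    apply IZR_le; lia. }
  destruct (HB2 y (fun n => gaussian y (- Z.of_nat (S n) + 1))
              (fun j => (INR j + 2) * gaussian y (Z.of_nat j))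
              (fun n => f (- Z.of_nat (S n))%Z)) as [Hex2 H2]; auto.
  { intros i; apply Rlt_le, gaussian_pos. }
  { intros i; rewrite !gaussian_neg_index; now apply gaussian_decr. }
  { now apply gaussian_le_1. }
  { intros i; rewrite gaussian_neg_index; pose proof (pos_INR i).
    pose proof (gaussian_pos y (Z.of_nat i)); nra. }
  { intros i; eapply Rle_trans; [apply Hf|].
    rewrite gaussian_neg_index, opp_IZR, Rabs_Ropp, <- INR_IZR_INZ.
    rewrite Rabs_pos_eq by apply pos_INR.
    rewrite S_INR; apply Req_le; ring. }
  split; [split; assumption|].
  rewrite Hmean in H2.
  unfold ZSeries, gaussian_series; rewrite RtoC_plus.
  match type of H1 with Cmod ?a <= _ => match type of H2 with Cmod ?b <= _ =>
    match goal with |- Cmod ?g <= _ => replace g with (a + b)%C by ring end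
  end end.
  eapply Rle_trans; [apply Cmod_triangle | lra].
Qed.

(** For [y] below [1 / (2 pi (n + 1)^2)] the inequality [exp (- t) >= 1 - t] makes each weight with
    [0 <= m <= n] at least 1/2. Their sum is at least [n / 2], which exceeds [A] by the choice of
    [n]. *)
Lemma gaussian_series_unbounded (A : R) :
  exists y0, 0 < y0 /\ forall y, 0 < y < y0 -> A < gaussian_series y.
Proof.
  destruct (INR_unbounded (4 * Rmax A 0)) as [n Hn].
  assert (HA : A <= Rmax A 0) by apply Rmax_l.
  assert (HA0 : 0 <= Rmax A 0) by apply Rmax_r.
  exists (/ (2 * PI * (INR n + 1) ^ 2)).
  pose proof PI_ge_1; pose proof (pos_INR n).
  assert (Hd : 0 < 2 * PI * (INR n + 1) ^ 2) by nra.
  split; [now apply Rinv_0_lt_compat|].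
  intros y [Hy Hyb].
  assert (Hyb' : y * (2 * PI * (INR n + 1) ^ 2) < 1).
  { apply (Rmult_lt_compat_r _ _ _ Hd) in Hyb; rewrite Rinv_l in Hyb; lra. }
  destruct (gaussian_moment y Hy) as [Hex _].
  assert (Hexg : ex_series (fun j => gaussian y (Z.of_nat (S j)))).
  { refine (@ex_series_le R_AbsRing R_CompleteNormedModule _ _ _ Hex).
    intros j; cbv [norm]; cbn -[gaussian INR Z.of_nat]; unfold abs; cbn -[gaussian INR Z.of_nat].
    pose proof (gaussian_pos y (Z.of_nat (S j))); pose proof (pos_INR j).
    rewrite Rabs_pos_eq; nra. }
  assert (Hexg0 : ex_series (fun j => gaussian y (Z.of_nat j)))
    by now apply ex_series_incr_1.
  assert (Hhalf : forall m, (m <= n)%nat -> / 2 <= gaussian y (Z.of_nat m)).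
  { intros m Hm; unfold gaussian; rewrite <- INR_IZR_INZ.
    pose proof (exp_ineq1_le (- (PI * y * INR m ^ 2))).
    assert (INR m <= INR n) by now apply le_INR.
    pose proof (pos_INR m).
    assert (INR m ^ 2 <= (INR n + 1) ^ 2) by nra.
    assert (0 <= PI * y) by nra.
    assert (PI * y * INR m ^ 2 <= PI * y * (INR n + 1) ^ 2) by nra.
    lra. }
  assert (Hsum : forall m, (m <= n)%nat ->
            INR m * / 2 <= sum_n (fun j => gaussian y (Z.of_nat j)) m).
  { induction m as [|m IH]; intros Hm.
    - rewrite sum_O; pose proof (gaussian_pos y (Z.of_nat 0)); cbn [INR]; lra.
    - rewrite sum_Sn, S_INR; cbv [plus]; cbn -[gaussian INR Z.of_nat sum_n].
      pose proof (Hhalf (S m) Hm); pose proof (IH ltac:(lia)); lra. }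
  pose proof (Hsum n (le_n n)).
  pose proof (sum_n_le_Series (fun j => gaussian y (Z.of_nat j)) n
                (fun i => Rlt_le _ _ (gaussian_pos y _)) Hexg0) as HS.
  unfold gaussian_series.
  rewrite (Series_ext _ _ (gaussian_neg_index y)).
  assert (Hpos : 0 <= Series (fun n => gaussian y (Z.of_nat n + 1))).
  { rewrite (Series_ext _ _ (gaussian_pos_index y)).
    eapply Rle_trans; [|apply (sum_n_le_Series _ 0); [|exact Hexg]].
    - rewrite sum_O; apply Rlt_le, gaussian_pos.
    - intros i; apply Rlt_le, gaussian_pos. }
  lra.
Qed.

(** * Complex limits *)

Lemma filterlim_Cmod {T} (F : (T -> Prop) -> Prop) (f : T -> C) (l : C) :
  Filter F ->
  (forall eps : posreal, F (fun t => Cmod (f t - l) < eps)) ->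
  filterlim f F (locally l).
Proof.
  intros HF H; apply filterlim_locally; intros eps.
  eapply filter_imp; [|apply (H eps)].
  intros t Ht; now apply C_NormedModule_mixin_compat1.
Qed.

(** Continuity of multiplication is available for the uniform structure of [C_AbsRing]; [locally_C]
    transfers it to the product structure on pairs of reals. *)
Lemma filterlim_Cmult {T} (F : (T -> Prop) -> Prop) (f g : T -> C) (l m : C) :
  Filter F -> filterlim f F (locally l) -> filterlim g F (locally m) ->
  filterlim (fun t => f t * g t)%C F (locally (l * m)%C).
Proof.
  intros HF Hf Hg.
  assert (H := fun x y => @filterlim_mult C_AbsRing x y).
  refine (filterlim_comp_2 f g Cmult Hf Hg _).
  intros P HP; apply locally_C in HP.
  destruct (H l m P HP) as [Q R HQ HR HPQ].
  exists Q R; [now apply locally_C | now apply locally_C | exact HPQ].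
Qed.

Lemma filterlim_Cexp_affine (a b : C) :
  filterlim (fun y : R => Cexp (a + y * b)%C) (at_right 0) (locally (Cexp a)).
Proof.
  refine (filterlim_filter_le_1 (F := locally 0) _ _ _); [apply filter_le_within|].
  replace (Cexp a) with (Cexp (a + 0 * b)%C) by (f_equal; ring).
  destruct a as [a1 a2], b as [b1 b2].
  assert (H : forall f : R -> R, ex_derive f 0 -> filterlim f (locally 0) (locally (f 0)))
    by (intros f; exact (ex_derive_continuous (K := R_AbsRing) (V := R_NormedModule) f 0)).
  assert (H2 : forall f g : R -> R, ex_derive f 0 -> ex_derive g 0 ->
     filterlim (fun y => (f y, g y) : C) (locally 0) (locally ((f 0, g 0) : C))).
  { intros f g Hf Hg P [d Hd].
    generalize (proj1 (filterlim_locally f (f 0)) (H f Hf) d).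
    generalize (proj1 (filterlim_locally g (g 0)) (H g Hg) d).
    intros H1 H3; unfold filtermap.
    eapply filter_imp; [|exact (filter_and _ _ H3 H1)].
    intros y [Hy1 Hy2]; apply Hd; now split. }
  apply (H2 (fun y => exp (Re ((a1, a2) + y * (b1, b2))%C)
                      * cos (Im ((a1, a2) + y * (b1, b2))%C))
            (fun y => exp (Re ((a1, a2) + y * (b1, b2))%C)
                      * sin (Im ((a1, a2) + y * (b1, b2))%C)));
    cbn; auto_derive; auto.
Qed.

(** The error [f/g - Lf/Lg] equals [((f - Lf G) Lg - Lf (g - Lg G)) / (g Lg)]. Its numerator is
    bounded by [K], while [|g| >= |Lg| G - Bg] tends to infinity. *)
Lemma filterlim_quotient (f g : R -> C) (G : R -> R) (Lf Lg : C) (Bf Bg : R) :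
  (forall A, exists y0, 0 < y0 /\ forall y, 0 < y < y0 -> A < G y) ->
  Lg <> 0%C ->
  (forall y, 0 < y < 1 -> Cmod (f y - Lf * G y)%C <= Bf) ->
  (forall y, 0 < y < 1 -> Cmod (g y - Lg * G y)%C <= Bg) ->
  at_right 0 (fun y => g y <> 0%C) /\
  filterlim (fun y => f y / g y)%C (at_right 0) (locally (Lf / Lg)%C).
Proof.
  intros HG HL Hf Hg.
  assert (HLg : 0 < Cmod Lg) by now apply Cmod_gt_0.
  assert (Hlarge : forall A, at_right 0 (fun y => 0 < y < 1 /\ A < Cmod (g y))).
  (* Beyond this threshold [|Lg| G] exceeds [A + Bg]; the maximum with 0 makes [G y] positive. *)
  { intros A; destruct (HG (Rmax 0 ((A + Bg) / Cmod Lg))) as (y0 & Hy0 & HGy).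
    assert (Hd : 0 < Rmin y0 1) by (apply Rmin_glb_lt; lra).
    exists (mkposreal _ Hd); cbn; intros y Hy Hpos.
    change (Rabs (y - 0) < Rmin y0 1) in Hy.
    rewrite Rminus_0_r, Rabs_pos_eq in Hy by lra.
    assert (y < y0) by (eapply Rlt_le_trans; [exact Hy | apply Rmin_l]).
    assert (y < 1) by (eapply Rlt_le_trans; [exact Hy | apply Rmin_r]).
    split; [lra|].
    assert (HGA := HGy y (conj Hpos H)).
    assert (HG0 : 0 < G y) by (eapply Rle_lt_trans; [apply Rmax_l | exact HGA]).
    assert (HGB : (A + Bg) / Cmod Lg < G y)
      by (eapply Rle_lt_trans; [apply Rmax_r | exact HGA]).
    apply (Rmult_lt_compat_r (Cmod Lg) _ _ HLg) in HGB.
    unfold Rdiv in HGB; rewrite Rmult_assoc, Rinv_l, Rmult_1_r in HGB by lra.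
    assert (HT := Cmod_triangle (g y) (- (g y - Lg * G y))%C).
    replace (g y + - (g y - Lg * G y))%C with (Lg * G y)%C in HT by ring.
    rewrite Cmod_opp, Cmod_mult, Cmod_R, Rabs_pos_eq in HT by lra.
    pose proof (Hg y (conj Hpos H0)); lra. }
  split.
  { eapply filter_imp; [|apply (Hlarge 0)].
    intros y [_ H]; now apply Cmod_gt_0. }
  apply filterlim_Cmod; [apply at_right_proper_filter|]; intros eps.
  set (K := Bf * Cmod Lg + Cmod Lf * Bg).
  eapply filter_imp; [|apply (Hlarge (Rmax 0 (K / (eps * Cmod Lg))))].
  intros y [Hy HA].
  assert (Hg0 : 0 < Cmod (g y)) by (eapply Rle_lt_trans; [apply Rmax_l | exact HA]).
  assert (HgK : K / (eps * Cmod Lg) < Cmod (g y))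
    by (eapply Rle_lt_trans; [apply Rmax_r | exact HA]).
  assert (Hgn : g y <> 0%C) by now apply Cmod_gt_0.
  pose proof (cond_pos eps) as Heps.
  assert (Hp : 0 < eps * Cmod Lg) by nra.
  apply (Rmult_lt_compat_r _ _ _ Hp) in HgK.
  unfold Rdiv in HgK; rewrite Rmult_assoc, Rinv_l, Rmult_1_r in HgK by lra.
  replace (f y / g y - Lf / Lg)%C
    with (((f y - Lf * G y) * Lg + - (Lf * (g y - Lg * G y))) / (g y * Lg))%C
    by (field; auto).
  rewrite Cmod_div by now apply Cmult_neq_0.
  assert (HN : Cmod ((f y - Lf * G y) * Lg + - (Lf * (g y - Lg * G y))) <= K).
  { eapply Rle_trans; [apply Cmod_triangle|].
    rewrite Cmod_opp, !Cmod_mult; unfold K.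
    pose proof (Hf y Hy); pose proof (Hg y Hy); pose proof (Cmod_ge_0 Lf).
    apply Rplus_le_compat;
      [apply Rmult_le_compat_r | apply Rmult_le_compat_l]; lra. }
  rewrite Cmod_mult.
  assert (Hd : 0 < Cmod (g y) * Cmod Lg) by nra.
  apply (Rmult_lt_reg_r _ _ _ Hd).
  unfold Rdiv; rewrite Rmult_assoc, Rinv_l, Rmult_1_r by lra; nra.
Qed.

(** * The Gauss sum *)

Lemma Csum_periodic_shift (g : Z -> C) (M s : nat) :
  (forall n, g (n + Z.of_nat M)%Z = g n) ->
  Csum (fun j => g (Z.of_nat j + Z.of_nat s)%Z) M
  = Csum (fun j => g (Z.of_nat j)) M.
Proof.
  intros Hper; induction s as [|s IH].
  - apply Csum_ext; intros i _; f_equal; lia.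
  - rewrite <- IH; set (F := fun j => g (Z.of_nat j + Z.of_nat s)%Z).
    transitivity (Csum (fun i => F (S i)) M).
    { apply Csum_ext; intros i _; unfold F; f_equal; lia. }
    assert (HF : F M = F O).
    { unfold F; rewrite <- (Hper (Z.of_nat 0 + Z.of_nat s)%Z); f_equal; lia. }
    assert (H := Csum_head F M); cbn [Csum] in H; rewrite HF in H.
    replace (Csum (fun i => F (S i)) M)
      with (F O + Csum (fun i => F (S i)) M - F O)%C by ring.
    rewrite <- H; ring.
Qed.

(** This is [(-1)^m e(h m^2 / (2 k))], with the sign written as [e(m / 2)] so that only real phases
    need to be compared. *)
Definition gauss_phase (h k m : Z) : C :=
  e (IZR h * IZR m ^ 2 / (2 * IZR k) + IZR m / 2)%R.

(** Replacing [m] by [m + k] adds [h m + k (h + 1) / 2] to the phase, an integer because [h] is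
    odd. *)
Lemma gauss_phase_periodic (h k m : Z) :
  (0 < k)%Z -> Z.Odd h -> gauss_phase h k (m + k) = gauss_phase h k m.
Proof.
  intros Hk [b Hb]; unfold gauss_phase.
  assert (Hk0 : IZR k <> 0) by (apply not_0_IZR; lia).
  symmetry; rewrite <- (e_real_periodic _ (h * m + k * (b + 1))); do 2 f_equal.
  rewrite Hb, !plus_IZR, !mult_IZR, !plus_IZR, !mult_IZR; field; exact Hk0.
Qed.

(* If the sum vanished, so would all its twists
   [sum_j f(j) e(h j t / k) = sum_j f(j + t) / f(t)] with [f = gauss_phase h k];
   but by orthogonality these add up to [k f(0)]. *)
Lemma gauss_phase_sum_neq_0 (h : Z) (k : nat) :
  (0 < k)%nat -> Z.Odd h -> Z.gcd h (Z.of_nat k) = 1%Z ->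
  Csum (fun j => gauss_phase h (Z.of_nat k) (Z.of_nat j + 1)) k <> 0%C.
Proof.
  intros Hk Hodd Hgcd H0.
  set (f := gauss_phase h (Z.of_nat k)) in *.
  set (K := IZR (Z.of_nat k)) in *.
  assert (HK : K <> 0) by (apply not_0_IZR; lia).
  assert (Hper : forall n, f (n + Z.of_nat k)%Z = f n)
    by (intros n; apply gauss_phase_periodic; [lia | assumption]).
  set (chi := fun j t : nat => e (IZR h * INR j * INR t / K)%R).
  (* The cross term of [(j + t)^2] gives [f(t) f(j) chi(j, t) = f(j + t)], so [f(t)] times the twist
     is a shifted full sum. *)
  assert (Htwist : forall t, Csum (fun j => f (Z.of_nat j) * chi j t)%C k = 0%C).
  { intros t.
    assert (Ht : (f (Z.of_nat t)
                  * Csum (fun j => f (Z.of_nat j) * chi j t) k)%C = 0%C).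
    { rewrite <- Csum_scal, <- H0.
      transitivity (Csum (fun j => f (Z.of_nat j + Z.of_nat t)%Z) k).
      - apply Csum_ext; intros j _; unfold f, gauss_phase, chi; fold K.
        rewrite <- !e_real_plus; do 2 f_equal.
        rewrite plus_IZR, !INR_IZR_INZ; field; exact HK.
      - rewrite Csum_periodic_shift by exact Hper.
        now rewrite <- (Csum_periodic_shift f k 1 Hper). }
    rewrite <- (Cmult_1_l (Csum _ _)), <- (Cinv_l (f (Z.of_nat t)))
      by apply e_real_neq_0.
    rewrite <- Cmult_assoc, Ht; ring. }
  (* Shifting [t] by one multiplies the sum by [e(h j / k)]; a nonzero sum would force this factor
     to be 1, hence [k] to divide [j] by coprimality with [h]. *)
  assert (Hortho : forall j, (0 < j < k)%nat -> Csum (chi j) k = 0%C).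
  { intros j Hj.
    set (g := fun t : Z => e (IZR h * INR j * IZR t / K)%R).
    assert (Hg : forall n, g (n + Z.of_nat k)%Z = g n).
    { intros n; unfold g.
      rewrite <- (e_real_periodic (_ * IZR n / K) (h * Z.of_nat j)); do 2 f_equal.
      rewrite plus_IZR, mult_IZR, INR_IZR_INZ; fold K; field; exact HK. }
    assert (Hchi : Csum (chi j) k = Csum (fun t => g (Z.of_nat t)) k).
    { apply Csum_ext; intros t _; unfold chi, g; now rewrite <- INR_IZR_INZ. }
    assert (Hz : (g 1%Z * Csum (chi j) k)%C = Csum (chi j) k).
    { rewrite Hchi at 2; rewrite <- (Csum_periodic_shift g k 1 Hg), <- Csum_scal.
      apply Csum_ext; intros t _; unfold g, chi.
      rewrite <- e_real_plus; do 2 f_equal.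
      rewrite plus_IZR, (INR_IZR_INZ t); cbn; field; exact HK. }
    destruct (Ceq_dec (Csum (chi j) k) 0%C) as [E|E]; [exact E | exfalso].
    assert (Hg1 : g 1%Z = 1%C).
    { replace (g 1%Z) with (g 1%Z * Csum (chi j) k / Csum (chi j) k)%C
        by (field; exact E).
      rewrite Hz; field; exact E. }
    destruct (e_real_eq_1 _ Hg1) as [n Hn].
    assert (Hn' : (h * Z.of_nat j = n * Z.of_nat k)%Z).
    { apply eq_IZR; rewrite !mult_IZR, <- Hn, INR_IZR_INZ; fold K.
      field; exact HK. }
    assert (Hdiv : (Z.of_nat k | Z.of_nat j)%Z).
    { apply (Z.gauss _ h); [exists n; lia | now rewrite Z.gcd_comm]. }
    apply Z.divide_pos_le in Hdiv; lia. }
  assert (Htot : Csum (fun t => Csum (fun j => f (Z.of_nat j) * chi j t)%C k) k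
                 = 0%C).
  { rewrite (Csum_ext _ (fun _ => 0%C)) by (intros; apply Htwist).
    rewrite Csum_const; ring. }
  rewrite Csum_switch in Htot.
  rewrite (Csum_ext _ (fun j => f (Z.of_nat j) * Csum (chi j) k)%C) in Htot
    by (intros; apply Csum_scal).
  destruct k as [|k']; [lia|].
  rewrite Csum_head in Htot.
  rewrite (Csum_ext _ (fun _ => 0%C) k') in Htot
    by (intros i Hi; rewrite Hortho by lia; ring).
  rewrite Csum_const in Htot.
  assert (H1 : Csum (chi O) (S k') = INR (S k')).
  { rewrite (Csum_ext _ (fun _ => 1%C)), Csum_const; [ring|].
    intros i _; unfold chi; rewrite <- (e_IZR 0); do 2 f_equal.
    cbn [INR]; field; exact HK. }
  assert (Hf0 : f (Z.of_nat 0) = 1%C).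
  { unfold f, gauss_phase; rewrite <- (e_IZR 0); do 2 f_equal.
    cbn [Z.of_nat]; fold K; field; exact HK. }
  rewrite H1, Hf0 in Htot.
  apply (not_0_INR (S k')); [lia|]; apply RtoC_inj.
  rewrite <- Htot; ring.
Qed.

(** * Polar forms of the summands *)

(** Multiplying [1 - s <= exp (- s)] by [exp s] gives [exp s - 1 <= s exp s]. *)
Lemma exp_minus_1_le (s S : R) : 0 <= s <= S -> Rabs (exp s - 1) <= s * exp S.
Proof.
  intros [H0 HS].
  pose proof (exp_ineq1_le s); pose proof (exp_ineq1_le (- s)).
  rewrite exp_Ropp in H1.
  pose proof (exp_pos s) as Hp.
  assert (H2 : / exp s * exp s = 1) by (apply Rinv_l; lra).
  assert (H4 : (1 + - s) * exp s <= / exp s * exp s)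
    by (apply Rmult_le_compat_r; lra).
  assert (H3 : exp s <= exp S).
  { destruct (Rle_lt_or_eq_dec _ _ HS) as [Hlt|<-]; [|lra].
    now apply Rlt_le, exp_increasing. }
  assert (s * exp s <= s * exp S) by (apply Rmult_le_compat_l; lra).
  rewrite Rabs_pos_eq by lra; lra.
Qed.

(** The factor [1 + exp (- s)] covers both signs of [s], and it cancels later against the same
    factor in the lower bound for [|1 - z exp (- s)|]. *)
Lemma exp_opp_minus_1_le (s : R) :
  Rabs (exp (- s) - 1) <= Rabs s * (1 + exp (- s)).
Proof.
  pose proof (exp_ineq1_le s); pose proof (exp_ineq1_le (- s)).
  pose proof (exp_pos (- s)) as Hp; pose proof (exp_pos s).
  assert (H2 : exp s * exp (- s) = 1)
    by (rewrite <- exp_plus, Rplus_opp_r; apply exp_0).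
  assert (H3 : (1 + s) * exp (- s) <= exp s * exp (- s))
    by (apply Rmult_le_compat_r; lra).
  unfold Rabs at 1; destruct (Rcase_abs _);
    unfold Rabs; destruct (Rcase_abs _); nra.
Qed.

(* With [c = Re z]:
   [|1 - z r|^2 = (1 + c)/2 (1 - r)^2 + (1 - c)/2 (1 + r)^2]. *)
Lemma Cmod_1_minus_scal_ge (z : C) (r : R) : Cmod z = 1 -> 0 <= r ->
  Cmod (1 - z) * (1 + r) / 2 <= Cmod (1 - z * r).
Proof.
  intros Hz Hr.
  assert (Hz2 : Re z ^ 2 + Im z ^ 2 = 1) by (rewrite <- Cmod2_alt, Hz; ring).
  assert (H0 : 0 <= Cmod (1 - z) * (1 + r) / 2)
    by (pose proof (Cmod_ge_0 (1 - z)); nra).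
  rewrite <- (Rabs_pos_eq _ H0).
  rewrite <- (Rabs_pos_eq (Cmod (1 - z * r))) by apply Cmod_ge_0.
  apply Rsqr_le_abs_0; rewrite !Rsqr_pow2.
  replace ((Cmod (1 - z) * (1 + r) / 2) ^ 2)
    with (Cmod (1 - z) ^ 2 * ((1 + r) ^ 2 / 4)) by field.
  rewrite !Cmod2_alt.
  destruct z as [c s]; cbn [Re Im fst snd] in Hz2; cbn.
  assert (Hc : -1 <= c <= 1) by nra.
  replace (1 + - (c * r - s * 0)) with (1 - c * r) by ring.
  replace (0 + - (c * 0 + s * r)) with (- (s * r)) by ring.
  replace (0 + - s) with (- s) by ring.
  replace (((1 + - c) * ((1 + - c) * 1) + - s * (- s * 1)) * ((1 + r) * ((1 + r) * 1) / 4))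
    with ((1 - 2 * c + (c ^ 2 + s ^ 2)) * (1 + r) ^ 2 / 4) by field.
  replace ((1 - c * r) * ((1 - c * r) * 1) + - (s * r) * (- (s * r) * 1))
    with (1 - 2 * c * r + (c ^ 2 + s ^ 2) * r ^ 2) by ring.
  rewrite Hz2.
  assert (0 <= (1 + c) * (1 - r) ^ 2) by (apply Rmult_le_pos; [lra | apply pow2_ge_0]).
  nra.
Qed.

Lemma polar_eq (r r' t t' : R) : r = r' -> t = t' ->
  (exp r * e t)%C = (exp r' * e t')%C.
Proof. now intros -> ->. Qed.

Lemma half_pair (x y : R) : ((x, y) / 2)%C = (x / 2, y / 2).
Proof. unfold Cdiv, Cmult, Cinv; cbn; f_equal; field. Qed.

Lemma qpow_polar (x y r : R) :
  qpow (x, y) r = (exp (- (2 * PI * r * y)) * e (r * x)%R)%C.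
Proof.
  apply Cexp_polar; cbn; ring.
Qed.

Lemma qpow_plus (tau : C) (r s : R) :
  qpow tau (r + s) = (qpow tau r * qpow tau s)%C.
Proof. unfold qpow; rewrite <- e_plus, RtoC_plus; f_equal; ring. Qed.

Lemma powerRZ_m1 (n : Z) : RtoC (powerRZ (-1) n) = e (IZR n / 2)%R.
Proof.
  assert (H2 : forall m, powerRZ (-1) (2 * m) = 1).
  { intros m; replace (2 * m)%Z with (m + m)%Z by ring.
    rewrite powerRZ_add, <- powerRZ_mult by lra.
    replace (-1 * -1) with 1 by ring; apply powerRZ_R1. }
  destruct (Z.Even_or_Odd n) as [[m ->]|[m ->]].
  - rewrite H2, mult_IZR.
    replace (2 * IZR m / 2) with (IZR m) by field; now rewrite e_IZR.
  - rewrite powerRZ_add, H2 by lra.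
    replace (IZR (2 * m + 1) / 2) with (/ 2 + IZR m)
      by (rewrite plus_IZR, mult_IZR; field).
    rewrite e_real_periodic, e_real.
    replace (2 * PI * / 2) with PI by field.
    rewrite cos_PI, sin_PI, powerRZ_1; unfold RtoC; f_equal; ring.
Qed.

(** Completing the square: [v^2 + v = (n + 1)^2 - 1/4] for [v = n + 1/2], which moves the centre of
    the Gaussian to [n = -1]. *)
Lemma theta_term_polar (h k : Z) (y : R) (n : Z) : (0 < k)%Z ->
  let x := IZR h / IZR k in
  theta_term ((x, y) / 2)%C (x, y) n
  = (exp (PI * y / 4) * gaussian y (n + 1)
     * (e (- (x / 8) - 1 / 4)%R * gauss_phase h k (n + 1)))%C.
Proof.
  intros Hk x.
  assert (Hk0 : IZR k <> 0) by (apply not_0_IZR; lia).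
  pose proof PI_neq0.
  unfold theta_term, gauss_phase, gaussian; rewrite half_pair.
  rewrite <- (RtoC_mult (exp _) (exp _)), <- exp_plus, <- e_real_plus.
  apply Cexp_polar; rewrite plus_IZR; cbn; unfold x; field; auto.
Qed.

(** Since [2 alpha = (A / N) tau + a / 2], the product [e(2 alpha) q^n] is [e(a / 2) q^b]. *)
Lemma mu_denominator_polar (A a N : Z) (x y : R) (n : Z) : (0 < N)%Z ->
  let b := IZR n + IZR A / IZR N in
  (1 - Cexp (2 * PI * Ci * (2 * alpha A a N (x, y))) * qpow (x, y) (IZR n))%C
  = (1 - e (x * b + IZR a / 2)%R * exp (- (2 * PI * y * b)))%C.
Proof.
  intros HN b; f_equal.
  assert (HN0 : IZR N <> 0) by (apply not_0_IZR; lia).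
  assert (HNC : RtoC (IZR N) <> 0%C) by (intros H; apply HN0, RtoC_inj, H).
  replace (Cexp (2 * PI * Ci * (2 * alpha A a N (x, y)))%C)
    with (qpow (x, y) (IZR A / IZR N) * e (IZR a / 2)%R)%C.
  + replace (qpow (x, y) (IZR A / IZR N) * e (IZR a / 2)%R * qpow (x, y) (IZR n))%C
      with (qpow (x, y) (IZR n + IZR A / IZR N) * e (IZR a / 2)%R)%C
      by (rewrite qpow_plus; ring).
    rewrite qpow_polar, <- Cmult_assoc, <- e_real_plus; fold b.
    rewrite (Cmult_comm (e _)); apply polar_eq; ring.
  + unfold qpow; rewrite <- e_plus; unfold e, alpha.
    rewrite !RtoC_div by lra; f_equal; field; auto.
Qed.

(** Here [n / 2 + n (n + 1) / 2 = ((n + 1)^2 - 1) / 2], so the numerator has the same Gaussian and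
    the same quadratic phase as the theta series. *)
Lemma mu_term_polar (h k A a N : Z) (y : R) (n : Z) : (0 < k)%Z -> (0 < N)%Z ->
  let x := IZR h / IZR k in
  let b := IZR n + IZR A / IZR N in
  mu_term (2 * alpha A a N (x, y))%C ((x, y) / 2)%C (x, y) n
  = (exp (PI * y) * gaussian y (n + 1)
     * (e (- (x / 2) - 1 / 2)%R * gauss_phase h k (n + 1))
     / (1 - e (x * b + IZR a / 2)%R * exp (- (2 * PI * y * b))))%C.
Proof.
  intros Hk HN x b.
  assert (Hk0 : IZR k <> 0) by (apply not_0_IZR; lia).
  assert (HN0 : IZR N <> 0) by (apply not_0_IZR; lia).
  unfold mu_term; f_equal.
  - replace (Cexp (2 * PI * Ci * IZR n * ((x, y) / 2))%C)
      with (qpow (x, y) (IZR n / 2))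
      by (unfold qpow, e; rewrite RtoC_div by lra; f_equal; field).
    rewrite <- Cmult_assoc, <- qpow_plus, powerRZ_m1, qpow_polar.
    unfold gauss_phase, gaussian.
    rewrite <- (RtoC_mult (exp _) (exp _)), <- exp_plus, <- e_real_plus.
    rewrite (Cmult_comm (e _) (_ * _)%C), <- Cmult_assoc, <- e_real_plus.
    apply polar_eq; rewrite plus_IZR; unfold x; field; auto.
  - now apply mu_denominator_polar.
Qed.

(** * Asymptotics at a rational point *)

Lemma periodic_Z_bounded (f : Z -> R) (M : nat) :
  (0 < M)%nat -> (forall n, f (n + Z.of_nat M)%Z = f n) ->
  exists K, forall n, f n <= K.
Proof.
  intros HM Hper.
  destruct (periodic_Z_nat _ f M Hper) as [Hp Hn].
  destruct (periodic_bounded _ M HM Hp) as [K1 H1].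
  destruct (periodic_bounded _ M HM Hn) as [K2 H2].
  exists (Rmax K1 K2); intros n.
  destruct (Z_lt_le_dec n 0) as [Hlt|Hge].
  - eapply Rle_trans; [|apply Rmax_r].
    replace n with (- Z.of_nat (S (Z.to_nat (- n - 1))))%Z by lia; apply H2.
  - eapply Rle_trans; [|apply Rmax_l].
    replace n with (Z.of_nat (Z.to_nat n)) by lia; apply H1.
Qed.

Lemma Cmod_gauss_phase (h k m : Z) : Cmod (gauss_phase h k m) = 1.
Proof. apply Cmod_e_real. Qed.

(** The only deviation from periodic times Gaussian is the global factor
    [exp (pi y / 4) = 1 + O(y)]. The coefficient [L] is a unit times the Gauss sum divided by
    [k]. *)
Lemma theta_asymptotic (h : Z) (k : nat) :
  (0 < k)%nat -> Z.Odd h -> Z.gcd h (Z.of_nat k) = 1%Z ->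
  let x := IZR h / IZR (Z.of_nat k) in
  exists (L : C) (B : R), L <> 0%C /\ forall y, 0 < y < 1 ->
    ex_ZSeries (theta_term ((x, y) / 2)%C (x, y)) /\
    Cmod (theta ((x, y) / 2)%C (x, y) - L * gaussian_series y)%C <= B.
Proof.
  intros Hk Hodd Hgcd x.
  set (z := e (- (x / 8) - 1 / 4)%R).
  set (c := fun n => (z * gauss_phase h (Z.of_nat k) (n + 1))%C).
  assert (Hper : forall n, c (n + Z.of_nat k)%Z = c n).
  { intros n; unfold c.
    replace (n + Z.of_nat k + 1)%Z with (n + 1 + Z.of_nat k)%Z by ring.
    now rewrite gauss_phase_periodic by (lia || assumption). }
  assert (HcM : forall n, Cmod (c n) = 1).
  { intros n; unfold c; rewrite Cmod_mult, Cmod_gauss_phase.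
    unfold z; rewrite Cmod_e_real; ring. }
  pose proof PI_ge_1 as HPI.
  set (K0 := PI / 4 * exp (PI / 4)).
  assert (HK0 : 0 <= K0)
    by (apply Rmult_le_pos; [lra | apply Rlt_le, exp_pos]).
  destruct (ZSeries_periodic_gauss c k K0 Hk Hper HK0) as [B HB].
  exists (Csum (fun j => c (Z.of_nat j)) k / INR k)%C, B; split.
  { unfold c, Cdiv; rewrite Csum_scal.
    assert (HkC : RtoC (INR k) <> 0%C)
      by (intros H; apply (not_0_INR k); [lia | now apply RtoC_inj]).
    repeat apply Cmult_neq_0.
    - apply e_real_neq_0.
    - now apply gauss_phase_sum_neq_0.
    - intros H; apply R1_neq_R0, RtoC_inj; rewrite <- (Cinv_r _ HkC), H; ring. }
  intros y Hy; apply HB; [exact Hy|]; intros n.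
  unfold x; rewrite theta_term_polar by lia; fold x; fold z; fold (c n).
  replace (exp (PI * y / 4) * gaussian y (n + 1) * c n - c n * gaussian y (n + 1))%C
    with ((exp (PI * y / 4) - 1)%R * gaussian y (n + 1) * c n)%C
    by (rewrite RtoC_minus; ring).
  pose proof (gaussian_pos y (n + 1)) as Hg.
  rewrite !Cmod_mult, HcM, !Cmod_R, (Rabs_pos_eq (gaussian _ _)), Rmult_1_r by lra.
  rewrite <- Rmult_assoc; apply Rmult_le_compat_r; [lra|].
  eapply Rle_trans; [apply (exp_minus_1_le _ (PI / 4)); nra|].
  replace (PI * y / 4 * exp (PI / 4)) with (K0 * y * 1) by (unfold K0; field).
  apply Rmult_le_compat_l; [nra|].
  pose proof (Rabs_pos (IZR n)); lra.
Qed.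

(** With [r = exp (- s)] the difference splits into [exp t z (r - 1) / ((1 - z r) (1 - z))] and
    [(exp t - 1) / (1 - z)]. In the first, [|r - 1| <= |s| (1 + r)] and
    [|1 - z r| >= |1 - z| (1 + r) / 2], so [1 + r] cancels and the bound is linear in [|s|] for [s]
    of any size and sign. *)
Lemma mu_kernel_bound (z : C) (s t S Q : R) :
  Cmod z = 1 -> z <> 1%C -> / Cmod (1 - z) <= Q -> 0 <= t <= S ->
  (1 - z * exp (- s))%C <> 0%C /\
  Cmod (exp t / (1 - z * exp (- s)) - 1 / (1 - z))%C
    <= exp S * (2 * Rabs s * Q ^ 2 + t * Q).
Proof.
  intros Hz Hz1 HQ Ht.
  set (r := exp (- s)).
  assert (Hr : 0 < r) by apply exp_pos.
  assert (H1z : (1 - z)%C <> 0%C).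
  { intros H; apply Hz1; replace z with (1 - (1 - z))%C by ring.
    rewrite H; ring. }
  pose proof (proj1 (Cmod_gt_0 _) H1z) as Hd.
  pose proof (Cmod_1_minus_scal_ge z r Hz (Rlt_le _ _ Hr)) as Hden.
  assert (Hdr : 0 < Cmod (1 - z) * (1 + r) / 2) by nra.
  assert (Hden0 : (1 - z * r)%C <> 0%C) by (apply Cmod_gt_0; lra).
  split; [exact Hden0|].
  replace (exp t / (1 - z * r) - 1 / (1 - z))%C
    with (exp t * (z * (r - 1)%R / ((1 - z * r) * (1 - z)))
          + (exp t - 1)%R / (1 - z))%C
    by (rewrite !RtoC_minus; field; auto).
  eapply Rle_trans; [apply Cmod_triangle|].
  rewrite Cmod_mult, !Cmod_div by (try apply Cmult_neq_0; assumption).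
  rewrite !Cmod_mult, !Cmod_R, Hz, Rmult_1_l.
  rewrite (Rabs_pos_eq (exp t)) by apply Rlt_le, exp_pos.
  pose proof (exp_minus_1_le t S Ht) as Ht1.
  pose proof (exp_opp_minus_1_le s) as Hs; fold r in Hs.
  assert (Hid : 0 < / Cmod (1 - z)) by now apply Rinv_0_lt_compat.
  assert (HtS : exp t <= exp S).
  { destruct (Rle_lt_or_eq_dec _ _ (proj2 Ht)) as [Hlt|<-]; [|lra].
    now apply Rlt_le, exp_increasing. }
  assert (H2 : Rabs (exp t - 1) / Cmod (1 - z) <= t * exp S * Q).
  { apply Rmult_le_compat; try lra; apply Rabs_pos. }
  assert (Hinv : / Cmod (1 - z * r) <= 2 * / Cmod (1 - z) * / (1 + r)).
  { replace (2 * / Cmod (1 - z) * / (1 + r))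
      with (/ (Cmod (1 - z) * (1 + r) / 2)) by (field; lra).
    now apply Rinv_le_contravar. }
  assert (H3 : Rabs (r - 1) / (Cmod (1 - z * r) * Cmod (1 - z))
               <= 2 * Rabs s * Q ^ 2).
  { unfold Rdiv; rewrite Rinv_mult.
    apply (Rle_trans _ (Rabs s * (1 + r)
             * (2 * / Cmod (1 - z) * / (1 + r) * / Cmod (1 - z)))).
    - apply Rmult_le_compat; try lra.
      + apply Rabs_pos.
      + apply Rmult_le_pos; [|lra].
        apply Rlt_le, Rinv_0_lt_compat; lra.
      + apply Rmult_le_compat_r; lra.
    - replace (Rabs s * (1 + r) * (2 * / Cmod (1 - z) * / (1 + r) * / Cmod (1 - z)))
        with (2 * Rabs s * (/ Cmod (1 - z)) ^ 2) by (field; lra).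
      apply Rmult_le_compat_l; [pose proof (Rabs_pos s); lra|].
      apply pow_incr; lra. }
  assert (H4 : exp t * (Rabs (r - 1) / (Cmod (1 - z * r) * Cmod (1 - z)))
               <= exp S * (2 * Rabs s * Q ^ 2)).
  { apply Rmult_le_compat; try assumption; [apply Rlt_le, exp_pos|].
    apply Rmult_le_pos; [apply Rabs_pos|].
    apply Rlt_le, Rinv_0_lt_compat, Rmult_lt_0_compat; lra. }
  lra.
Qed.

(** The nonintegrality hypothesis keeps each limiting denominator [1 - zeta n] away from 0. These
    have period [k] in [n], so their inverses have a common bound [Q], and the kernel estimate gives
    errors linear in [y (|n| + 1)]. *)
Lemma mu_asymptotic (h : Z) (k : nat) (A a N : Z) :
  (0 < k)%nat -> (0 < N)%Z -> Z.Odd h ->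
  let x := IZR h / IZR (Z.of_nat k) in
  (forall n j : Z, x * (IZR n + IZR A / IZR N) + IZR a / 2 <> IZR j) ->
  exists (L : C) (B : R), forall y, 0 < y < 1 ->
    let u := (2 * alpha A a N (x, y))%C in
    (forall n, (1 - Cexp (2 * PI * Ci * u) * qpow (x, y) (IZR n))%C <> 0%C) /\
    ex_ZSeries (mu_term u ((x, y) / 2)%C (x, y)) /\
    Cmod (ZSeries (mu_term u ((x, y) / 2)%C (x, y)) - L * gaussian_series y)%C <= B.
Proof.
  intros Hk HN Hodd x Hx.
  assert (HK : IZR (Z.of_nat k) <> 0) by (apply not_0_IZR; lia).
  set (zeta := fun n : Z => e (x * (IZR n + IZR A / IZR N) + IZR a / 2)%R).
  set (p := fun n => (e (- (x / 2) - 1 / 2)%R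
                      * gauss_phase h (Z.of_nat k) (n + 1))%C).
  set (c := fun n => (p n / (1 - zeta n))%C).
  assert (Hz1 : forall n, zeta n <> 1%C).
  { intros n Hn; destruct (e_real_eq_1 _ Hn) as [j Hj]; exact (Hx n j Hj). }
  (* The shift by [k] adds [x k = h], an integer, to the phase. *)
  assert (Hzper : forall n, zeta (n + Z.of_nat k)%Z = zeta n).
  { intros n; unfold zeta; rewrite <- (e_real_periodic (_ * (IZR n + _) + _) h).
    do 2 f_equal; rewrite plus_IZR; unfold x; field.
    split; [apply not_0_IZR; lia | exact HK]. }
  assert (Hper : forall n, c (n + Z.of_nat k)%Z = c n).
  { intros n; unfold c, p; rewrite Hzper.
    replace (n + Z.of_nat k + 1)%Z with (n + 1 + Z.of_nat k)%Z by ring.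
    now rewrite gauss_phase_periodic by (lia || assumption). }
  destruct (periodic_Z_bounded (fun n => / Cmod (1 - zeta n)) k Hk) as [Q HQ];
    [intros n; now rewrite Hzper|].
  assert (HQ0 : 0 <= Q).
  { eapply Rle_trans; [|apply (HQ 0%Z)].
    destruct (Req_dec (Cmod (1 - zeta 0%Z)) 0) as [->|H0];
      [rewrite Rinv_0; lra|].
    apply Rlt_le, Rinv_0_lt_compat.
    pose proof (Cmod_ge_0 (1 - zeta 0%Z)); lra. }
  pose proof PI_ge_1 as HPI.
  pose proof (exp_pos PI) as HE.
  assert (HA : 0 <= Rabs (IZR A)) by apply Rabs_pos.
  assert (HQ2 : 0 <= Q ^ 2) by apply pow2_ge_0.
  (* From the kernel bound with [t = pi y <= pi] and [|s| <= 2 pi y (|A| + 1) (|n| + 1)]. *)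
  set (K0 := exp PI * (4 * PI * (Rabs (IZR A) + 1) * Q ^ 2 + PI * Q)).
  assert (HK0 : 0 <= K0).
  { apply Rmult_le_pos; [lra|]; apply Rplus_le_le_0_compat; [|apply Rmult_le_pos; lra].
    apply Rmult_le_pos; [apply Rmult_le_pos; lra | exact HQ2]. }
  destruct (ZSeries_periodic_gauss c k K0 Hk Hper HK0) as [B HB].
  exists (Csum (fun j => c (Z.of_nat j)) k / INR k)%C, B.
  intros y Hy u.
  assert (Hkernel : forall n,
    let s := 2 * PI * y * (IZR n + IZR A / IZR N) in
    (1 - zeta n * exp (- s))%C <> 0%C /\
    Cmod (exp (PI * y) / (1 - zeta n * exp (- s)) - 1 / (1 - zeta n))%C
      <= exp PI * (2 * Rabs s * Q ^ 2 + PI * y * Q)).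
  { intros n s; apply mu_kernel_bound; auto; [apply Cmod_e_real | nra]. }
  assert (Hden : forall n, (1 - Cexp (2 * PI * Ci * u) * qpow (x, y) (IZR n))%C
             = (1 - zeta n * exp (- (2 * PI * y * (IZR n + IZR A / IZR N))))%C)
    by (intros n; apply mu_denominator_polar; exact HN).
  split; [intros n; rewrite Hden; apply Hkernel|].
  apply HB; [exact Hy|]; intros n.
  unfold u, x; rewrite mu_term_polar by lia; fold x.
  fold (zeta n); fold (p n).
  destruct (Hkernel n) as [Hne Hle].
  set (s := 2 * PI * y * (IZR n + IZR A / IZR N)) in *.
  assert (Hzn : (1 - zeta n)%C <> 0%C).
  { intros H; apply (Hz1 n); replace (zeta n) with (1 - (1 - zeta n))%C by ring.
    rewrite H; ring. }
  replace (exp (PI * y) * gaussian y (n + 1) * p n / (1 - zeta n * exp (- s))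
           - c n * gaussian y (n + 1))%C
    with (p n * (exp (PI * y) / (1 - zeta n * exp (- s)) - 1 / (1 - zeta n))
          * gaussian y (n + 1))%C
    by (unfold c; field; auto).
  pose proof (gaussian_pos y (n + 1)) as Hg.
  assert (Hp : Cmod (p n) = 1)
    by (unfold p; rewrite Cmod_mult, Cmod_gauss_phase, Cmod_e_real; ring).
  rewrite !Cmod_mult, Hp, Rmult_1_l, Cmod_R, Rabs_pos_eq by lra.
  rewrite <- Rmult_assoc; apply Rmult_le_compat_r; [lra|].
  eapply Rle_trans; [exact Hle|].
  set (m := Rabs (IZR n) + 1).
  assert (Hm : 1 <= m) by (unfold m; pose proof (Rabs_pos (IZR n)); lra).
  assert (HAN : Rabs (IZR A / IZR N) <= Rabs (IZR A)).
  { assert (HN1 : 1 <= IZR N) by (apply IZR_le; lia).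
    unfold Rdiv; rewrite Rabs_mult, (Rabs_pos_eq (/ IZR N))
      by (apply Rlt_le, Rinv_0_lt_compat; lra).
    rewrite <- (Rmult_1_r (Rabs (IZR A))) at 2.
    apply Rmult_le_compat_l; [lra|].
    rewrite <- Rinv_1; apply Rinv_le_contravar; lra. }
  assert (Hs : Rabs s <= 2 * PI * y * ((Rabs (IZR A) + 1) * m)).
  { unfold s; rewrite Rabs_mult, (Rabs_pos_eq (2 * PI * y)) by nra.
    apply Rmult_le_compat_l; [nra|].
    eapply Rle_trans; [apply Rabs_triang|]; unfold m in *; nra. }
  replace (K0 * y * m)
    with (exp PI * (2 * (2 * PI * y * ((Rabs (IZR A) + 1) * m)) * Q ^ 2
                    + PI * y * Q * m)) by (unfold K0; ring).
  apply Rmult_le_compat_l; [lra|].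
  apply Rplus_le_compat.
  - apply Rmult_le_compat_r; lra.
  - rewrite <- (Rmult_1_r (PI * y * Q)) at 1.
    apply Rmult_le_compat_l; [|lra].
    apply Rmult_le_pos; [nra | exact HQ0].
Qed.

(** * Radial limits *)

Lemma at_right_unit_interval : at_right 0 (fun y => 0 < y < 1).
Proof.
  exists (mkposreal 1 Rlt_0_1); intros y Hy Hpos; split; [exact Hpos|].
  change (Rabs (y - 0) < 1) in Hy.
  rewrite Rminus_0_r, Rabs_pos_eq in Hy; lra.
Qed.

Lemma filterlim_e_affine (a b : C) (x : R) :
  filterlim (fun y : R => Cexp (a * (x, y) + b)%C) (at_right 0)
    (locally (Cexp (a * x + b)%C)).
Proof.
  eapply filterlim_ext; [|apply (filterlim_Cexp_affine _ (a * Ci)%C)].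
  intros y; cbv beta; f_equal.
  replace ((x, y) : C) with (x + y * Ci)%C; [ring|].
  unfold Cplus, Cmult, RtoC, Ci; cbn; f_equal; ring.
Qed.

(** Both series are a constant times the same [gaussian_series y] up to a bounded error, so their
    quotient tends to [Lm / Lt]; the exponential prefactors are continuous up to the real point
    [x]. *)
Lemma V_formula_of_nonintegral (A a N h : Z) (k : nat) :
  (0 < N)%Z -> (0 < k)%nat -> Z.Odd h -> Z.gcd h (Z.of_nat k) = 1%Z ->
  let x := IZR h / IZR (Z.of_nat k) in
  (forall n j : Z, x * (IZR n + IZR A / IZR N) + IZR a / 2 <> IZR j) ->
  V_formula_at A a N x.
Proof.
  intros HN Hk Hodd Hgcd x Hx.
  destruct (theta_asymptotic h k Hk Hodd Hgcd) as (Lt & Bt & HLt & Ht).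
  destruct (mu_asymptotic h k A a N Hk HN Hodd Hx) as (Lm & Bm & Hm).
  fold x in Ht, Hm.
  destruct (filterlim_quotient
              (fun y => ZSeries (mu_term (2 * alpha A a N (x, y))%C
                                   ((x, y) / 2)%C (x, y)))
              (fun y => theta ((x, y) / 2)%C (x, y))
              gaussian_series Lm Lt Bm Bt gaussian_series_unbounded HLt) as [Hne Hlim].
  { intros y Hy; apply (Hm y Hy). }
  { intros y Hy; apply (Ht y Hy). }
  assert (HN0 : RtoC (IZR N) <> 0%C)
    by (intros H; apply (not_0_IZR N); [lia | now apply RtoC_inj]).
  set (m := (Cexp (PI * Ci * (2 * alpha A a N x)) * (Lm / Lt))%C).
  assert (Hdom : at_right 0 (fun y => mu_alpha_defined A a N (x, y))).
  { generalize (filter_and _ _ Hne at_right_unit_interval); apply filter_imp.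
    intros y [Hy Hy1]; destruct (Ht y Hy1) as [H1 _], (Hm y Hy1) as (H2 & H3 & _).
    exact (conj H1 (conj Hy (conj H2 H3))). }
  assert (Hmu : filterlim (fun y => mu_alpha A a N (x, y)) (at_right 0) (locally m)).
  { eapply filterlim_ext;
      [|refine (filterlim_Cmult _
                  (fun y => Cexp (PI * Ci * (2 * alpha A a N (x, y)))%C)
                  _ _ _ _ _ Hlim)].
    - intros y; unfold mu_alpha, mu; cbv beta.
      generalize (theta ((x, y) / 2)%C (x, y))
        (ZSeries (mu_term (2 * alpha A a N (x, y))%C ((x, y) / 2)%C (x, y)))
        (Cexp (PI * Ci * (2 * alpha A a N (x, y)))%C).
      intros t z w; unfold Cdiv; ring.
    - unfold alpha.
      replace (PI * Ci * (2 * (IZR A / (2 * IZR N) * x + IZR a / 4)))%C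
        with (PI * Ci * (IZR A / IZR N) * x + PI * Ci * (IZR a / 2))%C
        by (field; exact HN0).
      eapply filterlim_ext; [|apply filterlim_e_affine].
      intros y; cbv beta; f_equal; field; exact HN0. }
  exists m; split; [now split|]; split; [exact Hdom|].
  unfold V; apply filterlim_Cmult; [apply at_right_proper_filter | | exact Hmu].
  apply filterlim_Cmult;
    [apply at_right_proper_filter | apply filterlim_const |].
  unfold qpow, e.
  set (r := - ((2 * IZR A - IZR N) ^ 2 / (8 * IZR N ^ 2))).
  replace (- (IZR N - 2 * IZR A) ^ 2 / (8 * IZR N ^ 2)) with r
    by (unfold r, Rdiv; ring).
  replace (2 * PI * Ci * (r * x))%C with (2 * PI * Ci * r * x + 0)%C by ring.
  eapply filterlim_ext; [|apply filterlim_e_affine].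
  intros y; cbv beta; f_equal; ring.
Qed.

(** * The action of [G_alpha] on cusps *)

(* [S_alpha] in terms of a coprime pair [(h, k)] representing the cusp
   [h / k], with [k = 0] allowed since intermediate images in a word of
   generators may be infinite. *)
Definition cusp_ok (a N h k : Z) : Prop :=
  Z.gcd h k = 1%Z /\ Z.Odd h /\
  (((a = 0%Z \/ a = 2%Z) /\ ~ (N | h)%Z) \/
   ((a = 1%Z \/ a = 3%Z) /\
    (~ (N | 2 * h)%Z \/ (~ (N | h)%Z /\ Z.Even k)))).

(** Both pairs represent the same cusp; this restores a positive denominator after a matrix has
    produced a negative one. *)
Lemma cusp_ok_opp (a N h k : Z) : cusp_ok a N h k -> cusp_ok a N (- h) (- k).
Proof.
  intros (Hg & Ho & HP); repeat split.
  - now rewrite Z.gcd_opp_l, Z.gcd_opp_r.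
  - destruct Ho as [b Hb]; exists (- b - 1)%Z; lia.
  - replace (2 * - h)%Z with (- (2 * h))%Z by ring.
    rewrite !Z.divide_opp_r.
    assert (HE : Z.Even k -> Z.Even (- k)) by (intros [b Hb]; exists (- b)%Z; lia).
    tauto.
Qed.

(** The numerator is fixed, and the parity of the denominator enters only for odd [a], where [r = 2]
    preserves it. *)
Lemma cusp_ok_lower (a N h k : Z) : (0 <= a <= 3)%Z ->
  let r := if Z.even a then 1%Z else 2%Z in
  cusp_ok a N h (r * h + k) <-> cusp_ok a N h k.
Proof.
  intros Ha r; unfold cusp_ok.
  assert (Hg : Z.gcd h (r * h + k) = Z.gcd h k)
    by (rewrite Z.add_comm; apply Z.gcd_add_mult_diag_r).
  rewrite Hg.
  assert (HE : a = 1%Z \/ a = 3%Z -> (Z.Even (r * h + k) <-> Z.Even k)).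
  { intros Hodd; assert (r = 2%Z) as -> by (destruct Hodd as [-> | ->]; reflexivity).
    split; intros [b Hb]; [exists (b - h)%Z | exists (b + h)%Z]; lia. }
  tauto.
Qed.

(** The translation [s] is a multiple of both [N] and 2, so it changes neither the divisibility of
    [h] and [2 h] by [N] nor the parity of [h]. *)
Lemma cusp_ok_upper (a N h k : Z) :
  let s := if Z.even N then N else (2 * N)%Z in
  cusp_ok a N (h + s * k) k <-> cusp_ok a N h k.
Proof.
  intros s.
  assert (Hs : (N | s)%Z /\ (2 | s)%Z).
  { unfold s; destruct (Z.even N) eqn:E.
    - split; [apply Z.divide_refl|].
      apply Z.even_spec in E; destruct E as [b Hb]; exists b; lia.
    - split; [exists 2%Z; ring | exists N; ring]. }
  destruct Hs as [HsN [c Hc]].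
  assert (HD : forall m, (N | m * (h + s * k))%Z <-> (N | m * h)%Z).
  { intros m.
    assert (H1 : (N | m * k * s)%Z) by now apply Z.divide_mul_r.
    replace (m * (h + s * k))%Z with (m * h + m * k * s)%Z by ring.
    split; intros H; [|now apply Z.divide_add_r].
    replace (m * h)%Z with (m * h + m * k * s - m * k * s)%Z by ring.
    now apply Z.divide_sub_r. }
  pose proof (HD 1%Z) as HD1; rewrite !Z.mul_1_l in HD1; pose proof (HD 2%Z) as HD2.
  assert (HO : Z.Odd (h + s * k) <-> Z.Odd h).
  { split; intros [b Hb]; [exists (b - c * k)%Z | exists (b + c * k)%Z]; nia. }
  assert (Hg : Z.gcd (h + s * k) k = Z.gcd h k).
  { rewrite Z.gcd_comm, (Z.gcd_comm h); apply Z.gcd_add_mult_diag_r. }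
  unfold cusp_ok; rewrite Hg; tauto.
Qed.

(** An equivalence, quantified over all pairs, is what the induction needs: the inverse case reads
    the hypothesis backwards at the image under the inverse matrix. *)
Lemma cusp_ok_generated (a N : Z) (M : SL2Z) :
  (0 <= a <= 3)%Z -> G_alpha a N M ->
  forall h k, cusp_ok a N (m11 M * h + m12 M * k) (m21 M * h + m22 M * k)
              <-> cusp_ok a N h k.
Proof.
  intros Ha HM; induction HM as [M [-> | ->] | | M M' _ IHM _ IHM' | M _ IHM];
    intros h k.
  - cbn [SL2Z_lower m11 m12 m21 m22].
    rewrite !Z.mul_1_l, Z.mul_0_l, Z.add_0_r; now apply cusp_ok_lower.
  - cbn [SL2Z_upper m11 m12 m21 m22].
    rewrite !Z.mul_1_l, Z.mul_0_l, Z.add_0_l; apply cusp_ok_upper.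
  - cbn [SL2Z_one m11 m12 m21 m22].
    now rewrite !Z.mul_1_l, !Z.mul_0_l, Z.add_0_l, Z.add_0_r.
  - etransitivity; [|apply IHM'].
    etransitivity; [|apply IHM]; cbn [SL2Z_mul m11 m12 m21 m22].
    match goal with |- cusp_ok _ _ ?u ?v <-> cusp_ok _ _ ?u' ?v' =>
      replace u with u' by ring; replace v with v' by ring end.
    reflexivity.
  - etransitivity; [symmetry; apply IHM|]; cbn [SL2Z_inv m11 m12 m21 m22].
    pose proof (SL2Z_det M) as Hd.
    match goal with |- cusp_ok _ _ ?u ?v <-> _ =>
      replace u with ((m11 M * m22 M - m12 M * m21 M) * h)%Z by ring;
      replace v with ((m11 M * m22 M - m12 M * m21 M) * k)%Z by ring end.
    rewrite Hd, !Z.mul_1_l; reflexivity.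
Qed.

(** Integrality would give [2 h (n N + A) = (2 j - a) k N]. As [N] is coprime to [A], it is coprime
    to [n N + A], so [N] divides [2 h]. If [a] or [k] is even, the factor 2 cancels first and [N]
    divides [h]. *)
Lemma cusp_ok_nonintegral (A a N h k : Z) :
  (0 < N)%Z -> (0 < k)%Z -> Z.gcd A N = 1%Z -> cusp_ok a N h k ->
  forall n j : Z,
    IZR h / IZR k * (IZR n + IZR A / IZR N) + IZR a / 2 <> IZR j.
Proof.
  intros HN Hk HAN (_ & _ & HP) n j H.
  assert (HZ : (2 * h * (n * N + A) = (2 * j - a) * k * N)%Z).
  { apply eq_IZR; rewrite !mult_IZR, minus_IZR, plus_IZR, !mult_IZR, <- H.
    field; split; apply not_0_IZR; lia. }
  assert (HdivA : forall m, (N | m * (n * N + A))%Z -> (N | m)%Z).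
  { intros m [c Hc]; apply (Z.gauss _ A); [|now rewrite Z.gcd_comm].
    exists (c - m * n)%Z; lia. }
  assert (H2h : (N | 2 * h)%Z) by (apply HdivA; rewrite HZ; now exists ((2 * j - a) * k)%Z).
  destruct HP as [[Ha Hh] | [Ha [Hh | [Hh [l Hl]]]]].
  - apply Hh, HdivA; destruct Ha as [-> | ->];
      [exists (j * k)%Z | exists ((j - 1) * k)%Z]; lia.
  - now apply Hh.
  - apply Hh, HdivA; exists ((2 * j - a) * l)%Z; nia.
Qed.

Lemma V_formula_of_cusp_ok (A a N h k : Z) :
  (0 < N)%Z -> Z.gcd A N = 1%Z -> cusp_ok a N h k -> k <> 0%Z ->
  V_formula_at A a N (IZR h / IZR k).
Proof.
  intros HN HAN.
  assert (Hpos : forall h k, cusp_ok a N h k -> (0 < k)%Z ->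
            V_formula_at A a N (IZR h / IZR k)).
  { clear h k; intros h k Hok Hk.
    pose proof (cusp_ok_nonintegral A a N h k HN Hk HAN Hok) as Hx.
    destruct Hok as (Hg & Ho & _).
    rewrite <- (Z2Nat.id k) in * by lia.
    apply V_formula_of_nonintegral; auto; lia. }
  intros Hok Hk.
  destruct (Z_lt_le_dec 0 k) as [Hlt|Hle]; [now apply Hpos|].
  replace (IZR h / IZR k) with (IZR (- h) / IZR (- k))
    by (rewrite !opp_IZR; field; now apply not_0_IZR).
  apply Hpos; [now apply cusp_ok_opp | lia].
Qed.

(** * From rational points to cusps, and the conclusion *)

Lemma S_alpha_cusp_ok (a N : Z) (x : Q) : S_alpha a N x ->
  exists h k, (x == h # k)%Q /\ cusp_ok a N h (Zpos k).
Proof.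
  unfold S_alpha, S_C1, S_C2, S_ev, reduced, cusp_ok.
  intros [[Ha (h & k & [Hg Hx] & Ho & Hh)] |
          [Ha [(h & k & [Hg Hx] & Ho & Hh) | (h & k & [Hg Hx] & Ho & Hh & Hk)]]];
    exists h, k; tauto.
Qed.

Lemma Q2R_inject_Z (n : Z) : Q2R (inject_Z n) = IZR n.
Proof. unfold Q2R, inject_Z; cbn; field. Qed.

Lemma Q2R_make (x : Q) (h : Z) (k : positive) :
  (x == h # k)%Q -> Q2R x = IZR h / IZR (Zpos k).
Proof. intros H; now rewrite (Qeq_eqR _ _ H). Qed.

(** The image is written through the integer vector [M (h, k)], the form in which the cusp condition
    is known to be invariant. *)
Lemma Q2R_moebius (M : SL2Z) (x : Q) (h : Z) (k : positive) :
  (x == h # k)%Q -> finite_image M x ->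
  (m21 M * h + m22 M * Zpos k <> 0)%Z /\
  Q2R (moebius M x)
  = IZR (m11 M * h + m12 M * Zpos k) / IZR (m21 M * h + m22 M * Zpos k).
Proof.
  intros Hx Hfin.
  assert (Hk : IZR (Zpos k) <> 0) by (apply not_0_IZR; lia).
  assert (E : Q2R (inject_Z (m21 M) * x + inject_Z (m22 M))
              = IZR (m21 M * h + m22 M * Zpos k) / IZR (Zpos k)).
  { rewrite Q2R_plus, Q2R_mult, !Q2R_inject_Z, (Q2R_make x h k Hx).
    rewrite plus_IZR, !mult_IZR; field; exact Hk. }
  assert (Hd : (m21 M * h + m22 M * Zpos k <> 0)%Z).
  { intros H0; apply Hfin, eqR_Qeq; rewrite E, H0.
    unfold Q2R; cbn; field; exact Hk. }
  split; [exact Hd|].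
  pose proof (not_0_IZR _ Hd) as HdR.
  unfold moebius; rewrite Q2R_div by exact Hfin; rewrite E.
  rewrite Q2R_plus, Q2R_mult, !Q2R_inject_Z, (Q2R_make x h k Hx).
  rewrite (plus_IZR (m11 M * h)), !(mult_IZR (m11 M)), !(mult_IZR (m12 M)).
  field; auto.
Qed.

Theorem theorem4p3 (A a N : Z)
  (hN : (0 < N)%Z) (ha : (0 <= a <= 3)%Z) (hAN : Z.gcd A N = 1%Z) :
  quantum_set (mu_alpha_defined A a N) (V A a N) (S_alpha a N) (G_alpha a N) /\
  (forall (x : Q) (M : SL2Z), S_alpha a N x -> G_alpha a N M ->
     V_formula_at A a N (Q2R x) /\
     (finite_image M x -> V_formula_at A a N (Q2R (moebius M x)))).
Proof.
  assert (H : forall (x : Q) (M : SL2Z), S_alpha a N x -> G_alpha a N M ->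
     V_formula_at A a N (Q2R x) /\
     (finite_image M x -> V_formula_at A a N (Q2R (moebius M x)))).
  { intros x M HS HM.
    destruct (S_alpha_cusp_ok a N x HS) as (h & k & Hx & Hok); split.
    - rewrite (Q2R_make x h k Hx); apply V_formula_of_cusp_ok; auto; lia.
    - intros Hfin; destruct (Q2R_moebius M x h k Hx Hfin) as [Hd ->].
      apply V_formula_of_cusp_ok; auto.
      now apply cusp_ok_generated. }
  split; [|exact H].
  (* The formula contains the existence of the radial limit of [V]; the quantum set property forgets
     its value. *)
  intros x M HS HM; destruct (H x M HS HM) as [(m & _ & Hm) HMx].
  split; [now eexists; exact Hm|].
  intros Hfin; destruct (HMx Hfin) as (m' & _ & Hm'); now eexists; exact Hm'.
Qed.
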